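(* Let $\lambda\in[0,1]$ and let $\theta=\theta(w)\in\mathbb{R}^n$ be the Emphatic-TD($\lambda$)-solution for the target policy $\pi_w$, i.e. the solution of $\lim_{t\to\infty}\mathbb{E}[\rho_t\delta_te_t]=0$, where $\delta_t=r_{t+1}+\gamma\theta^\top\phi_{t+1}-\theta^\top\phi_t$, $e_t=m_t\phi_t+\gamma\lambda\rho_{t-1}e_{t-1}$, $e_{-1}=0$, $m_t=1+\gamma\rho_{t-1}(m_{t-1}-\lambda)$, $m_{-1}=\lambda$. Let $J(w)=\sum_s d(s)\,\theta(w)^\top\phi(s)=\theta(w)^\top\mathbb{E}[\phi_t]$. Define recursively, for $t\ge0$, $$f^\lambda_t=m_t+\gamma\lambda\rho_{t-1}f^\lambda_{t-1},$$ $$z_t=\gamma\rho_{t-1}\big((m_{t-1}-\lambda)\nabla\log\pi_w(a_{t-1}|s_{t-1})+z_{t-1}\big),$$ $$\psi_t=f^\lambda_t\,\nabla\log\pi_w(a_t|s_t)+z_t+\gamma\lambda\rho_{t-1}\psi_{t-1},$$ with $f^\lambda_{-1}=0$, $z_{-1}=0$, $\psi_{-1}=0$ (and, at $t=0$, all terms involving index $-1$ other than $m_{-1}-\lambda=0$ vanish, so $m_0=1$, $z_0=0$). Then, regardless of whether the problem is on-policy ($\pi_w=\pi_b$) or off-policy, and for every value of $\lambda$, $$\nabla J(w)=\lim_{t\to\infty}\mathbb{E}[\rho_t\,\delta_t\,\psi_t],$$ where $\delta_t$ is evaluated at $\theta=\theta(w)$.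
   Context: Setting: a Markov decision process with finite state set $\mathcal{S}$, finite or infinite action set $\mathcal{A}$, transition probabilities $P(s'|s,a)$, real-valued rewards $r(s,a,s')$, and discount factor $\gamma\in[0,1)$. For infinite $\mathcal{A}$, sums over actions are read as integrals and policies as densities. Data $(s_t,a_t,r_{t+1},s_{t+1})_{t\ge0}$ are generated by a fixed stationary behavior policy $\pi_b$ with $\pi_b(a|s)>0$ for all $(s,a)$: $a_t\sim\pi_b(\cdot|s_t)$, $s_{t+1}\sim P(\cdot|s_t,a_t)$, $r_{t+1}=r(s_t,a_t,s_{t+1})$. The state process is irreducible, aperiodic and in steady state, with stationary distribution $d$ satisfying $d(s)>0$ for all $s$. $\mathbb{E}$ denotes expectation over these data; all expectations involved are assumed finite. The target policy $\pi_w$ is parametrized by $w\in\mathbb{R}^K$; $w\mapsto\pi_w(a|s)$ is twice differentiable for every $(s,a)$, $\sup_{w,s,a}\|\nabla\log\pi_w(a|s)\|<\infty$, and $\nabla\log\pi_w(a|s)$ has bounded derivative. $\nabla$ denotes the gradient (column vector) with respect to $w$. The importance ratio is $\rho_t=\pi_w(a_t|s_t)/\pi_b(a_t|s_t)$. Each state $s$ has a feature vector $\phi(s)\in\mathbb{R}^n$; $\phi_t=\phi(s_t)$. The feature matrix $\Phi\in\mathbb{R}^{|\mathcal{S}|\times n}$, whose row $s$ is $\phi(s)^\top$, has linearly independent columns, and the $n$-th component of $\phi(s)$ equals $1$ for every $s$. Under these assumptions the matrix $A(\lambda)=\lim_{t\to\infty}\mathbb{E}[\rho_t e_t(\phi_t-\gamma\phi_{t+1})^\top]$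 is invertible, so the Emphatic-TD($\lambda$)-solution is unique. *)

(* Defs.v *)
From HB Require Import structures.
From mathcomp Require Export all_boot all_order all_algebra.
From mathcomp Require Export all_classical all_reals all_analysis.

Set Implicit Arguments.
Unset Strict Implicit.
Unset Printing Implicit Defensive.

Import Order.TTheory GRing.Theory Num.Theory.
Export numFieldNormedType.Exports.

Local Open Scope classical_set_scope.
Local Open Scope ring_scope.

Section MDP.
Context {R : realType} {S : finType} {dA : measure_display}
  {A : measurableType dA}.

(* [trans s a s'] is P(s'|s,a) and [reward s a s'] is r(s,a,s'). *)
Record mdp := MDP {
  trans : S -> A -> S -> R ;
  reward : S -> A -> S -> R ;
  trans_ge0 : forall s a s', 0 <= trans s a s' ;
  trans_sum1 : forall s a, \sum_s' trans s a s' = 1 ;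
  measurable_trans : forall s s',
    measurable_fun [set: A] (fun a => trans s a s') ;
  measurable_reward : forall s s',
    measurable_fun [set: A] (fun a => reward s a s')
}.

(* Policies are densities in the action with respect to a reference measure
   [mu]: counting measure when A is finite or countable, e.g. Lebesgue measure
   when A is continuous.  [p s a] is p(a|s). *)
Definition is_policy (mu : {sigma_finite_measure set A -> \bar R})
    (p : S -> A -> R) : Prop :=
  forall s, [/\ measurable_fun [set: A] (p s),
                (forall a, 0 <= p s a) &
                (\int[mu]_a (p s a)%:E = 1)%E].

Definition state_kernel (mu : {sigma_finite_measure set A -> \bar R})
    (M : mdp) (p : S -> A -> R) (s s' : S) : R :=
  \int[mu]_a (p s a * trans M s a s').

End MDP.
Arguments mdp R S {dA} A.

Section Chain.
Context {R : realType} {S : finType}.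
Variable k : S -> S -> R.

Fixpoint kernel_pow (n : nat) (s s' : S) : R :=
  if n is n'.+1 then \sum_u kernel_pow n' s u * k u s' else (s == s')%:R.

Definition irreducible_kernel : Prop :=
  forall s s', exists n : nat, 0 < kernel_pow n s s'.

(* For each s, the gcd of the return times {n >= 1 | k^n(s,s) > 0} is 1. *)
Definition aperiodic_kernel : Prop :=
  forall (s : S) (q : nat),
    (forall n : nat, (0 < n)%N -> 0 < kernel_pow n s s -> (q %| n)%N) ->
    q = 1%N.

Definition stationary_distribution (d : S -> R) : Prop :=
  [/\ (forall s, 0 <= d s), \sum_s d s = 1 &
      (forall s', \sum_s d s * k s s' = d s')].

End Chain.

Section Trajectory.
Context {R : realType} {S : finType} {dA dO : measure_display}
  {A : measurableType dA} {Omega : measurableType dO}.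

(* The sigma-algebra generated by s_0, ..., s_(i-1), a_0, ..., a_(j-1). *)
Definition history (St : nat -> Omega -> S) (At : nat -> Omega -> A)
    (i j : nat) : set (set Omega) :=
  <<s [set E | (exists t s, (t < i)%N /\ E = St t @^-1` [set s]) \/
               (exists t B, [/\ (t < j)%N, measurable B &
                                E = At t @^-1` B])] >>.

(* s_0 ~ d;  a_t ~ pb(.|s_t) conditionally on s_0, a_0, ..., a_(t-1), s_t;
   s_(t+1) ~ P(.|s_t,a_t) conditionally on s_0, a_0, ..., s_t, a_t. *)
Record is_trajectory (Pr : probability Omega R)
    (mu : {sigma_finite_measure set A -> \bar R}) (M : mdp R S A)
    (d : S -> R) (pb : S -> A -> R)
    (St : nat -> Omega -> S) (At : nat -> Omega -> A) : Prop := IsTrajectory {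
  traj_measurable_state : forall t s, measurable (St t @^-1` [set s]) ;
  traj_measurable_action : forall t, measurable_fun [set: Omega] (At t) ;
  traj_init : forall s, Pr (St 0%N @^-1` [set s]) = (d s)%:E ;
  traj_action : forall t H B, history St At t.+1 t H -> measurable B ->
    (Pr (H `&` At t @^-1` B) =
     \int[Pr]_(o in H) \int[mu]_(a in B) (pb (St t o) a)%:E)%E ;
  traj_state : forall t H s', history St At t.+1 t.+1 H ->
    (Pr (H `&` St t.+1 @^-1` [set s']) =
     \int[Pr]_(o in H) (trans M (St t o) (At t o) s')%:E)%E
}.

Definition vec_integrable n (Pr : probability Omega R)
    (X : Omega -> 'cV[R]_n) : Prop :=
  forall i, Pr.-integrable [set: Omega] (fun o => (X o i 0)%:E).

(* Entrywise expectation; used for [vec_integrable] vectors, so that [fine]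
   loses nothing. *)
Definition vec_expectation n (Pr : probability Omega R)
    (X : Omega -> 'cV[R]_n) : 'cV[R]_n :=
  \col_i fine ('E_Pr[fun o => X o i 0%R])%E.

End Trajectory.

Section Gradient.
Context {R : realType} {K : nat}.

Definition gradient (f : 'cV[R]_K -> R) (w : 'cV[R]_K) : 'cV[R]_K :=
  \col_i 'D_(delta_mx i 0) f w.

Definition twice_differentiable (f : 'cV[R]_K -> R) : Prop :=
  (forall w, differentiable f w) /\ (forall w, differentiable (gradient f) w).

Context {S A : Type}.
Variable p : 'cV[R]_K -> S -> A -> R.

Definition score (w : 'cV[R]_K) (s : S) (a : A) : 'cV[R]_K :=
  gradient (fun w' => ln (p w' s a)) w.

(* [`|_|] is the sup norm, equivalent to the Euclidean norm on R^K. *)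
Definition bounded_score : Prop :=
  exists C : R, forall w s a, `|score w s a| <= C.

Definition score_bounded_derivative : Prop :=
  forall s a, exists C : R, forall w v : 'cV[R]_K,
    `|'d (fun w' => score w' s a) w v| <= C * `|v|.

End Gradient.

(* Deterministic recursions along one trajectory, as functions of the
   importance ratios [rho], features [phi] and scores [g].  The boundary values
   at index -1 (m_(-1) = lambda, all other traces 0) are folded into the
   clauses for t = 0. *)
Section Traces.
Context {R : realType} {n K : nat}.
Variables (gamma lambda : R) (rho : nat -> R).

Fixpoint emphasis (t : nat) : R :=
  if t is t'.+1 then 1 + gamma * rho t' * (emphasis t' - lambda) else 1.

Fixpoint e_trace (phi : nat -> 'cV[R]_n) (t : nat) : 'cV[R]_n :=
  if t is t'.+1 then
    emphasis t *: phi t + (gamma * lambda * rho t') *: e_trace phi t'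
  else emphasis 0 *: phi 0%N.

Fixpoint f_trace (t : nat) : R :=
  if t is t'.+1 then emphasis t + gamma * lambda * rho t' * f_trace t'
  else emphasis 0.

Fixpoint z_trace (g : nat -> 'cV[R]_K) (t : nat) : 'cV[R]_K :=
  if t is t'.+1 then
    (gamma * rho t') *: ((emphasis t' - lambda) *: g t' + z_trace g t')
  else 0.

Fixpoint psi_trace (g : nat -> 'cV[R]_K) (t : nat) : 'cV[R]_K :=
  if t is t'.+1 then
    f_trace t *: g t + z_trace g t
      + (gamma * lambda * rho t') *: psi_trace g t'
  else f_trace 0 *: g 0%N + z_trace g 0.

End Traces.

Section EmphaticTD.
Context {R : realType} {S : finType} {dA dO : measure_display}
  {A : measurableType dA} {Omega : measurableType dO} {n K : nat}.

Definition feature_mx (phi : S -> 'cV[R]_n) : 'M[R]_(#|S|, n) :=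
  \matrix_(i, j) phi (enum_val i) j 0.

Definition value (phi : S -> 'cV[R]_n) (theta : 'cV[R]_n) (s : S) : R :=
  (theta^T *m phi s) 0 0.

Variables (M : mdp R S A) (gamma lambda : R) (phi : S -> 'cV[R]_n)
  (pb : S -> A -> R) (St : nat -> Omega -> S) (At : nat -> Omega -> A).

Definition ratio (p : S -> A -> R) (t : nat) (o : Omega) : R :=
  p (St t o) (At t o) / pb (St t o) (At t o).

Definition td_error (theta : 'cV[R]_n) (t : nat) (o : Omega) : R :=
  reward M (St t o) (At t o) (St t.+1 o)
    + gamma * value phi theta (St t.+1 o) - value phi theta (St t o).

Definition etd_update (p : S -> A -> R) (theta : 'cV[R]_n) (t : nat)
    (o : Omega) : 'cV[R]_n :=
  (ratio p t o * td_error theta t o) *: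
    e_trace gamma lambda (fun u => ratio p u o) (fun u => phi (St u o)) t.

Definition actor_update (p : 'cV[R]_K -> S -> A -> R) (w : 'cV[R]_K)
    (theta : 'cV[R]_n) (t : nat) (o : Omega) : 'cV[R]_K :=
  (ratio (p w) t o * td_error theta t o) *:
    psi_trace gamma lambda (fun u => ratio (p w) u o)
      (fun u => score p w (St u o) (At u o)) t.

Definition is_etd_solution (Pr : probability Omega R) (p : S -> A -> R)
    (theta : 'cV[R]_n) : Prop :=
  (fun t => vec_expectation Pr (etd_update p theta t)) @ \oo -->
    (0 : 'cV[R]_n).

End EmphaticTD.

(* Main.v *)
Require Import Defs.
From HB Require Import structures.
From mathcomp Require Import ring lra measurable_realfun.
Import Order.TTheory GRing.Theory Num.Theory.

(* The traces do not depend on lambda: pathwise m_t = lambda + (1 - lambda) f_t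
   and z_t = (1 - lambda) y_t, where f_(t+1) = 1 + gamma rho_t f_t and
   psi_t = f_t grad log pi_t + y_t, y_(t+1) = gamma rho_t psi_t; and since the
   last feature is 1, the last entry of e_t is f_t.
   Let P and r be the transition matrix and mean reward of pi_w,
   h = r + gamma P h its true value function, F = d + gamma F P, and v = Phi theta.
   The follow-on masses E[f_t 1(s_t = s)] converge to F, so the last entry of the
   ETD equation reads F (r + gamma P v - v) = 0, that is d v = d h.  Hence
   J(w) = d h, whatever lambda and the other features are, and
   grad J = F (grad r + gamma (grad P) h).  Likewise E[y_t 1(s_t = s)] converges to
   the solution Y of Y (I - gamma P) = gamma F grad P, and the limit of
   E[rho_t delta_t psi_t] is
     F (grad r + gamma (grad P) v) + Y (I - gamma P)(h - v)
   which is the same vector.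
   Gradients pass under the action integrals because a bounded score makes
   pi_w'(a|s) / pi_w(a|s) - 1 of order |w' - w| uniformly in a. *)

Set Implicit Arguments.
Unset Strict Implicit.
Unset Printing Implicit Defensive.

Local Open Scope classical_set_scope.
Local Open Scope ring_scope.

(** * Discounted linear recursions and first-order expansions *)

(** Origin of the actor trace: [grad rho_t = rho_t grad log pi_t] gives [y_t = grad f_t], hence
    [rho_t psi_t = grad (rho_t f_t)]. The theorem thus differentiates [lim E[rho_t f_t delta_t] = d
    h - d v] in w with theta frozen inside [delta_t]. Exchanging that gradient with the limit in t
    would require control uniform in w; instead both sides are computed in closed form and compared.
    No regularity of [theta] in w is assumed, so J cannot be differentiated through [theta]. The
    identity J = d h removes [theta], provided that it is established at every parameter and not
    only at the point of differentiation. The ratios [rho_t] may be unbounded, so the traces have no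
    pathwise bound. Their integrability is propagated one transition at a time, together with their
    expectations: a trace at time t contains ratios up to t - 1 only, so [a_t] and [s_(t+1)] can be
    integrated out given the past. Integrability of the rewards under each target policy is
    extracted from the ETD update at t = 0, where the follow-on trace is 1. *)

Lemma discounted_cvg0 {R : realType} (gamma : R) (a b : nat -> R) :
  0 <= gamma -> gamma < 1 -> (forall t, 0 <= a t) ->
  (forall t, a t.+1 <= gamma * a t + b t) ->
  b @ \oo --> 0 -> a @ \oo --> 0.
Proof.
move=> g0 g1 a0 ab b0; apply/cvgr0Pnorm_lt => e e0.
have gm : 0 < 1 - gamma by rewrite subr_gt0.
(* With perturbations below this constant, [e / 2] is the fixed point of the affine recursion, so
   the excess over [e / 2] decays like [gamma ^+ k]. *)
have e2 : 0 < e / 2 * (1 - gamma) by rewrite mulr_gt0// divr_gt0.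
have /cvgr0Pnorm_lt/(_ _ e2)[N _ bN] := b0.
have aN k : a (N + k)%N <= e / 2 + gamma ^+ k * a N.
  elim: k => [|k IH]; first by rewrite addn0 expr0 mul1r lerDr ltW// divr_gt0.
  rewrite addnS (le_trans (ab _))// exprS.
  have /= := bN (N + k)%N (leq_addr _ _); rewrite ltr_norml => /andP[_ bk].
  by have := ler_wpM2l g0 IH; lra.
have : (fun k => gamma ^+ k * a N) @ \oo --> 0 * a N.
  by apply: cvgMl; apply: cvg_expr; rewrite ger0_norm.
rewrite mul0r => /cvgr0Pnorm_lt/(_ (e / 2))[|M _ HM]; first by rewrite divr_gt0.
exists (N + M)%N => // t /= Nt; rewrite ger0_norm//.
have [k -> Mk] : exists2 k, t = (N + k)%N & (M <= k)%N.
  have NN : (N <= t)%N by apply: leq_trans Nt; exact: leq_addr.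
  by exists (t - N)%N; [rewrite subnKC|rewrite leq_subRL].
have := HM k Mk; rewrite /= ltr_norml => /andP[_].
have := aN k; lra.
Qed.

Lemma cvg_sumr {R : realType} {T : Type} (F : set_system T) {FF : Filter F}
    (I : finType) (f : I -> T -> R) (l : I -> R) :
  (forall i, f i @ F --> l i) ->
  (fun x => \sum_i f i x) @ F --> \sum_i l i.
Proof. by move=> fl; apply: cvg_big => // i; exact: add_continuous. Qed.

Section linear_recursions.
Context {R : realType} {S : finType}.
Variables (gamma : R) (P : S -> S -> R).
Hypotheses (gamma_ge0 : 0 <= gamma) (gamma_lt1 : gamma < 1).
Hypotheses (P_ge0 : forall s s', 0 <= P s s') (P_sum1 : forall s, \sum_s' P s s' = 1).

(** At a state m where [|x|] is maximal, the average of [|x|] under [P m] is at most [|x m|], so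
    [|x m| <= b + gamma |x m|]. *)
Lemma discounted_max_bound (x : S -> R) (b : R) :
  (forall s, `|x s| <= b + gamma * \sum_s' P s s' * `|x s'|) ->
  forall s, `|x s| <= b / (1 - gamma).
Proof.
move=> xb s; pose m := [arg max_(i > s | true) `|x i|]%O.
have xm i : `|x i| <= `|x m|.
  by rewrite /m; case: arg_maxP => // j _ /(_ i isT).
have gm : 0 < 1 - gamma by rewrite subr_gt0.
rewrite (le_trans (xm s))// ler_pdivlMr//.
have : \sum_s' P m s' * `|x s'| <= `|x m|.
  rewrite -[leRHS]mul1r -(P_sum1 m) mulr_suml.
  by apply: ler_sum => i _; rewrite ler_wpM2l.
by move=> /(ler_wpM2l gamma_ge0); have := xb m; lra.
Qed.

Let Q : 'M[R]_#|S| := \matrix_(i, j) P (enum_val i) (enum_val j).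

Let sum_enum (f : S -> R) : \sum_(i < #|S|) f (enum_val i) = \sum_s f s.
Proof. by rewrite -big_enum_val; apply: eq_bigl => s; rewrite inE. Qed.

Let mx_unit : 1%:M - gamma *: Q \in unitmx.
Proof.
(* Transposing makes the kernel equation read [x = gamma P x], an average along rows of P, to which
   [discounted_max_bound] applies with b = 0. *)
rewrite -unitmx_tr -row_free_unit; apply: inj_row_free => v v0.
pose x s := v 0 (enum_rank s).
have xE s : x s = gamma * \sum_s' P s s' * x s'.
  have /matrixP/(_ 0 (enum_rank s)) := v0.
  rewrite linearB/= linearZ/= trmx1 mulmxBr mulmx1 -scalemxAr !mxE => /eqP.
  rewrite subr_eq0 {1}/x => /eqP ->; congr (_ * _); rewrite -sum_enum.
  by apply: eq_bigr => i _; rewrite !mxE !enum_rankK /x enum_valK mulrC.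
have x0 s : `|x s| <= 0 / (1 - gamma).
  apply: (@discounted_max_bound x) => {}s; rewrite add0r [X in `|X| <= _]xE normrM ger0_norm//.
  rewrite ler_wpM2l// (le_trans (ler_norm_sum _ _ _))//.
  by apply: ler_sum => i _; rewrite normrM (ger0_norm (P_ge0 _ _)).
apply/rowP => i; rewrite mxE; apply/eqP; rewrite -normr_le0.
by have := x0 (enum_val i); rewrite mul0r /x enum_valK.
Qed.

Lemma discounted_value_exists (b : S -> R) :
  exists h : S -> R, forall s, h s = b s + gamma * \sum_s' P s s' * h s'.
Proof.
pose B : 'cV[R]_#|S| := \col_i b (enum_val i).
pose H := invmx (1%:M - gamma *: Q) *m B.
have HE : H = B + gamma *: (Q *m H).
  have : (1%:M - gamma *: Q) *m H = B by rewrite mulKVmx.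
  by rewrite mulmxBl mul1mx -scalemxAl => <-; rewrite subrK.
exists (fun s => H (enum_rank s) 0) => s; rewrite {1}HE !mxE enum_rankK.
congr (_ + _ * _); rewrite -sum_enum.
by apply: eq_bigr => i _; rewrite !mxE enum_rankK enum_valK.
Qed.

Lemma discounted_occupancy_exists (b : S -> R) :
  exists F : S -> R, forall s', F s' = b s' + gamma * \sum_s F s * P s s'.
Proof.
pose B : 'rV[R]_#|S| := \row_i b (enum_val i).
pose H := B *m invmx (1%:M - gamma *: Q).
have HE : H = B + gamma *: (H *m Q).
  have : H *m (1%:M - gamma *: Q) = B by rewrite mulmxKV.
  by rewrite mulmxBr mulmx1 -scalemxAr => <-; rewrite subrK.
exists (fun s => H 0 (enum_rank s)) => s; rewrite {1}HE !mxE enum_rankK.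
congr (_ + _ * _); rewrite -sum_enum.
by apply: eq_bigr => i _; rewrite !mxE enum_rankK enum_valK.
Qed.

(** The sup norm suits [x -> P x], but here x is a row vector: since the rows of P sum to 1,
    [x -> x P] does not increase the l1 norm. The l1 distance to F therefore obeys the recursion of
    [discounted_cvg0]. *)
Lemma discounted_occupancy_cvg (b : nat -> S -> R) (b_ F : S -> R) (x : nat -> S -> R) :
  (forall s, b ^~ s @ \oo --> b_ s) ->
  (forall s', F s' = b_ s' + gamma * \sum_s F s * P s s') ->
  (forall t s', x t.+1 s' = b t s' + gamma * \sum_s x t s * P s s') ->
  forall s, x ^~ s @ \oo --> F s.
Proof.
move=> bcvg FE xE.
suff : (fun t => \sum_s `|x t s - F s|) @ \oo --> 0.
  move=> S0 s; apply/cvgrPdist_lt => e e0.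
  have /cvgr0Pnorm_lt/(_ _ e0)[N _ HN] := S0.
  exists N => // t Nt; rewrite distrC; have /= := HN t Nt; apply: le_lt_trans.
  rewrite [leRHS]ger0_norm ?sumr_ge0// (bigD1 s)//= lerDl sumr_ge0//.
apply: (@discounted_cvg0 _ gamma _ (fun t => \sum_s `|b t s - b_ s|)) => //.
- by move=> t; rewrite sumr_ge0.
- move=> t; rewrite mulr_sumr.
  have -> : \sum_s gamma * `|x t s - F s| =
      \sum_s' gamma * \sum_s `|x t s - F s| * P s s'.
    rewrite -!mulr_sumr exchange_big/=; congr (_ * _); apply: eq_bigr => s _.
    by rewrite -mulr_sumr P_sum1 mulr1.
  rewrite -big_split/=; apply: ler_sum => s' _; rewrite xE FE.
  rewrite opprD addrACA -mulrBr -sumrB addrC (le_trans (ler_normD _ _))//.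
  rewrite lerD2r normrM ger0_norm// ler_wpM2l//.
  rewrite (le_trans (ler_norm_sum _ _ _))//; apply: ler_sum => s _.
  by rewrite -mulrBl normrM (ger0_norm (P_ge0 _ _)).
- have := @cvg_sumr R nat \oo _ S (fun s t => `|b t s - b_ s|) (fun=> 0).
  rewrite big1//; apply => s; rewrite -(@normr0 _ R) -(subrr (b_ s)).
  by apply: cvg_norm; apply: cvgB => //; exact: cvg_cst.
Qed.

(** The hypothesis reads [b = F (I - gamma P)]; moving [I - gamma P] onto x turns sums against b
    into sums of Bellman residuals against F. *)
Lemma sum_discounted_occupancy (b F x : S -> R) :
  (forall s', F s' = b s' + gamma * \sum_s F s * P s s') ->
  \sum_s b s * x s = \sum_s F s * (x s - gamma * \sum_s' P s s' * x s').
Proof.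
move=> FE.
have -> : \sum_s b s * x s = \sum_s F s * x s -
    gamma * \sum_s (\sum_s' F s' * P s' s) * x s.
  rewrite mulr_sumr -sumrB; apply: eq_bigr => s _.
  by rewrite {1}FE; ring.
under [RHS]eq_bigr do rewrite mulrBr mulrCA.
rewrite sumrB -mulr_sumr; congr (_ - _ * _).
under eq_bigr do rewrite mulr_suml.
rewrite exchange_big/=; apply: eq_bigr => s _; rewrite mulr_sumr.
by apply: eq_bigr => s' _; rewrite mulrA.
Qed.

End linear_recursions.


Lemma mx_entry_le_norm {R : realType} m n (M : 'M[R]_(m, n)) i j :
  `|M i j| <= `|M|.
Proof.
rewrite [leRHS]/Num.norm /= mx_normrE.
exact: (le_bigmax _ (fun ij => `|M ij.1 ij.2|) (i, j)).
Qed.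

(** * First-order expansions with explicit partial derivatives *)

Section first_order_expansion.
Context {R : realType} {K : nat}.
Implicit Types (f g : 'cV[R]_K -> R) (w : 'cV[R]_K) (G : 'I_K -> R).

(** Differentiability at w with the partial derivatives displayed as numbers [G i]. The epsilon form
    of the little-o can be summed, multiplied by continuous factors and compared with integrals
    directly. *)
Definition first_order f w G := forall e, 0 < e ->
  \forall x \near w, `|f x - f w - \sum_i (x - w) i 0 * G i| <= e * `|x - w|.

Section linear_part.
Variable G : 'I_K -> R.

Let lin (h : 'cV[R]_K) : R^o := \sum_i h i 0 * G i.

Let lin_linear : linear lin.
Proof.
move=> a u v; rewrite /lin scaler_sumr -big_split/=; apply: eq_bigr => i _.
by rewrite !mxE mulrDl -mulrA.
Qed.

HB.instance Definition _ := GRing.isLinear.Build R _ R^o _ lin lin_linear.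

Let lin_continuous : continuous (lin : 'cV[R]_K -> R^o).
Proof.
move=> h; apply: (@cvg_sumr _ _ (nbhs h)) => i; apply: cvgMl.
exact: (@coord_continuous _ _ _ i 0).
Qed.

Lemma first_order_diff f w : first_order f w G ->
  differentiable f w /\ forall h, 'd f w h = \sum_i h i 0 * G i.
Proof.
move=> fG.
(* The differential is defined along a filter, with [lim (nbhs w)] in the place of w, and is
   selected by [get]; exhibiting [lin] in exactly this shape gives existence, and [diff_unique] then
   identifies the selected map. *)
have E : forall y, f y = f (lim (nbhs w)) + lin (y - lim (nbhs w))
                  +o_(y \near w) (y - lim (nbhs w)).
  suff : f = (fun y => f (lim (nbhs w)) + lin (y - lim (nbhs w)))
     +o_w (fun y => y - lim (nbhs w)) by rewrite funeqE.
  apply/eqaddoP => e e0; rewrite lim_id//.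
  near=> y; rewrite !fctE opprD addrA; near: y; exact: fG.
have df : differentiable f w.
  apply/diffP => /=.
  apply: (@getPex _ (fun (df : {linear 'cV[R]_K -> R^o}) => continuous df /\
    forall y, f y = f (lim (nbhs w)) + df (y - lim (nbhs w))
                  +o_(y \near w) (y - lim (nbhs w)))).
  by exists (lin : {linear 'cV[R]_K -> R^o}).
split => // h.
suff -> : 'd f w = lin :> (_ -> _) by [].
apply: diff_unique => //.
apply/eqaddoP => e e0; have := fG e e0.
rewrite (near_shift 0 w) subr0; apply: filterS => x /=.
by rewrite addrK !fctE /= opprD addrA.
Unshelve. all: by end_near. Qed.

End linear_part.

Lemma first_order_continuous f w G : first_order f w G -> {for w, continuous f}.
Proof. by case/first_order_diff => /differentiable_continuous. Qed.

Lemma first_order_gradient f w G : first_order f w G ->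
  differentiable f w /\ gradient f w = \col_i G i.
Proof.
move=> /first_order_diff[df dfE]; split=> //; apply/colP => i.
rewrite !mxE deriveE// dfE (bigD1 i)//= mxE !eqxx mul1r big1 ?addr0// => j ji.
by rewrite mxE (negbTE ji) mul0r.
Qed.

Lemma first_order_cst (c : R) w : first_order (cst c) w (fun=> 0).
Proof.
move=> e e0; apply: (@nearW _ (nbhs w)) => x.
rewrite subrr sub0r normrN big1 => [|i _]; last by rewrite mulr0.
by rewrite normr0 mulr_ge0// ltW.
Qed.

Lemma first_orderD f g w G H : first_order f w G -> first_order g w H ->
  first_order (fun x => f x + g x) w (fun i => G i + H i).
Proof.
move=> fG gH e e0; have e2 : 0 < e / 2 by rewrite divr_gt0.
near=> x.
have fx : `|f x - f w - \sum_i (x - w) i 0 * G i| <= e / 2 * `|x - w|.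
  by near: x; exact: fG.
have gx : `|g x - g w - \sum_i (x - w) i 0 * H i| <= e / 2 * `|x - w|.
  by near: x; exact: gH.
under eq_bigr do rewrite mulrDr.
rewrite big_split/= [leRHS](_ : _ = e / 2 * `|x - w| + e / 2 * `|x - w|); last by field.
apply: le_trans (lerD fx gx); apply: le_trans (ler_normD _ _).
by rewrite le_eqVlt; apply/orP; left; apply/eqP; congr `|_|; ring.
Unshelve. all: by end_near. Qed.

Lemma first_order_sum (I : finType) (f : I -> 'cV[R]_K -> R) w (G : I -> 'I_K -> R) :
  (forall i, first_order (f i) w (G i)) ->
  first_order (fun x => \sum_i f i x) w (fun j => \sum_i G i j).
Proof.
move=> fG.
have -> : (fun x => \sum_i f i x) = \sum_i f i by apply/funext => x; rewrite fct_sumE.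
have -> : (fun j => \sum_i G i j) = \sum_i G i by apply/funext => x; rewrite fct_sumE.
elim/big_ind2 : _ => [|g1 G1 g2 G2 |i _]; [exact: first_order_cst| |exact: fG].
exact: first_orderD.
Qed.

(** Since the first factor vanishes at w, no derivative of g enters. This is how the value function
    can appear in an expansion once it is known to be merely continuous. *)
Lemma first_orderM_continuous f g w G : first_order f w G -> {for w, continuous g} ->
  first_order (fun x => (f x - f w) * g x) w (fun i => G i * g w).
Proof.
move=> fG gc e e0; set C := \sum_i `|G i|.
have C0 : 0 <= C by rewrite sumr_ge0.
(* [e1] pays for the remainder of f, multiplied by the bound [|g w| + 1] on g near w; [e2] bounds
   the increment of g, multiplied by the linear part of f, itself at most [C * |x - w|]. *)
pose e1 := e / 2 / (`|g w| + 1); pose e2 := e / 2 / (C + 1).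
have gw0 : 0 < `|g w| + 1 by rewrite ltr_wpDl.
have e10 : 0 < e1 by rewrite !divr_gt0.
have C10 : 0 < C + 1 by rewrite ltr_wpDl.
have e20 : 0 < e2 by rewrite !divr_gt0.
near=> x.
have fx : `|f x - f w - \sum_i (x - w) i 0 * G i| <= e1 * `|x - w|.
  by near: x; exact: fG.
have gx1 : `|g w - g x| < 1 by near: x; move/cvgrPdist_lt : gc; apply.
have gx2 : `|g w - g x| < e2 by near: x; move/cvgrPdist_lt : gc; apply.
have gx3 : `|g x| <= `|g w| + 1.
  have := ler_normD (g w) (g x - g w); rewrite [X in `|X| <= _]addrC subrK.
  by rewrite (distrC (g x)); lra.
rewrite subrr mul0r subr0.
have -> : (f x - f w) * g x - \sum_i (x - w) i 0 * (G i * g w) =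
   (f x - f w - \sum_i (x - w) i 0 * G i) * g x +
   (\sum_i (x - w) i 0 * G i) * (g x - g w).
  under eq_bigr do rewrite mulrA.
  by rewrite -mulr_suml; ring.
have lx : `|\sum_i (x - w) i 0 * G i| <= C * `|x - w|.
  rewrite (le_trans (ler_norm_sum _ _ _))// mulr_suml; apply: ler_sum => i _.
  by rewrite normrM mulrC ler_wpM2l// mx_entry_le_norm.
rewrite (le_trans (ler_normD _ _))// !normrM (distrC (g x)).
have h0 := normr_ge0 (x - w).
have A1 : `|f x - f w - \sum_i (x - w) i 0 * G i| * `|g x| <= e / 2 * `|x - w|.
  rewrite (le_trans (ler_pM _ _ fx gx3))//.
  by rewrite mulrAC /e1 divfK// gt_eqF.
have A2 : `|\sum_i (x - w) i 0 * G i| * `|g w - g x| <= e / 2 * `|x - w|.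
  rewrite (le_trans (ler_pM _ _ lx (ltW gx2)))// mulrAC ler_wpM2r//.
  rewrite /e2 mulrCA ler_piMr//; first by rewrite divr_ge0// ltW.
  by rewrite ler_pdivrMr// mul1r lerDl.
by rewrite [leRHS](_ : _ = e / 2 * `|x - w| + e / 2 * `|x - w|); [lra|field].
Unshelve. all: by end_near. Qed.

End first_order_expansion.

Lemma first_orderZ {R : realType} {K : nat} (c : R) (f : 'cV[R]_K -> R) w G :
  first_order f w G -> first_order (fun x => c * f x) w (fun i => c * G i).
Proof.
move=> fG e e0; have c0 : 0 < `|c| + 1 by rewrite ltr_wpDl.
near=> x.
have fx : `|f x - f w - \sum_i (x - w) i 0 * G i| <= e / (`|c| + 1) * `|x - w|.
  by near: x; apply: fG; rewrite divr_gt0.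
have -> : c * f x - c * f w - \sum_i (x - w) i 0 * (c * G i) =
    c * (f x - f w - \sum_i (x - w) i 0 * G i).
  by under eq_bigr do rewrite mulrCA; rewrite -mulr_sumr; ring.
rewrite normrM (le_trans (ler_wpM2l _ fx))// mulrA ler_wpM2r//.
by rewrite mulrCA ger_pMr// ler_pdivrMr// mul1r lerDl.
Unshelve. all: by end_near. Qed.

(** * Gradient of the stationary average of the discounted value function *)

Section discounted_value_gradient.
Context {R : realType} {S : finType} {K : nat}.
Variables (gamma : R) (P : 'cV[R]_K -> S -> S -> R) (r h : 'cV[R]_K -> S -> R).
Hypotheses (gamma_ge0 : 0 <= gamma) (gamma_lt1 : gamma < 1).
Hypotheses (P_ge0 : forall w s s', 0 <= P w s s')
           (P_sum1 : forall w s, \sum_s' P w s s' = 1).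
Hypothesis hE : forall w s, h w s = r w s + gamma * \sum_s' P w s s' * h w s'.
Variables (w : 'cV[R]_K) (DP : S -> S -> 'I_K -> R) (Dr : S -> 'I_K -> R).
Hypotheses (P_diff : forall s s', first_order (fun x => P x s s') w (DP s s'))
           (r_diff : forall s, first_order (fun x => r x s) w (Dr s)).

Lemma discounted_value_continuous s : {for w, continuous (h ^~ s)}.
Proof.
(* [D x] is the residual of [h w] in the Bellman equation of x, namely [r x + gamma P_x h_w - h_w].
   Hence [h_x - h_w = D x + gamma P_x (h_x - h_w)], and [discounted_max_bound] controls the
   increment of h by the residual, which tends to 0. *)
pose D x s := r x s - r w s + gamma * \sum_s' (P x s s' - P w s s') * h w s'.
have D0 s1 : D ^~ s1 @ w --> 0.
  rewrite -[0](addr0 0) -{2}(mulr0 gamma); apply: (@cvgD _ _ _ (nbhs w) _ (fun x => r x s1 - r w s1)).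
    by apply/subr_cvg0; exact: (first_order_continuous (r_diff _)).
  apply: (@cvgMr _ _ (nbhs w)).
  have := @cvg_sumr R _ (nbhs w) _ S
    (fun s' x => (P x s1 s' - P w s1 s') * h w s') (fun=> 0).
  rewrite big1//; apply => s'; rewrite -(mul0r (h w s')); apply: cvgMl.
  by apply/subr_cvg0; exact: (first_order_continuous (P_diff _ _)).
have SD0 : (fun x => \sum_s1 `|D x s1|) @ w --> 0.
  have := @cvg_sumr R _ (nbhs w) _ S (fun s1 x => `|D x s1|) (fun=> 0).
  rewrite big1//; apply => s'; rewrite -(@normr0 _ R).
  by apply: cvg_norm; exact: D0.
apply/(@cvgrPdist_lt _ _ _ (nbhs w)) => e e0.
have g0 : 0 < 1 - gamma by rewrite subr_gt0.
near=> x.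
have Dx : \sum_s1 `|D x s1| < e * (1 - gamma).
  rewrite -[ltLHS]ger0_norm ?sumr_ge0//; near: x.
  by move/cvgr0Pnorm_lt : SD0; apply; rewrite mulr_gt0.
rewrite distrC; apply: (@le_lt_trans _ _ ((\sum_s1 `|D x s1|) / (1 - gamma))).
  apply: (@discounted_max_bound _ _ gamma (P x) _ _ _ _ (fun s => h x s - h w s)) => // s1.
  have -> : h x s1 - h w s1 = D x s1 + gamma * \sum_s' P x s1 s' * (h x s' - h w s').
    rewrite [in LHS]hE [in LHS](hE w) /D.
    have -> : \sum_s' (P x s1 s' - P w s1 s') * h w s' =
        \sum_s' P x s1 s' * h w s' - \sum_s' P w s1 s' * h w s'.
      by rewrite -sumrB; apply: eq_bigr => s' _; rewrite mulrBl.
    have -> : \sum_s' P x s1 s' * (h x s' - h w s') =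
        \sum_s' P x s1 s' * h x s' - \sum_s' P x s1 s' * h w s'.
      by rewrite -sumrB; apply: eq_bigr => s' _; rewrite mulrBr.
    by ring.
  rewrite (le_trans (ler_normD _ _))// lerD//.
    by rewrite (bigD1 s1)//= lerDl sumr_ge0.
  rewrite normrM ger0_norm// ler_wpM2l// (le_trans (ler_norm_sum _ _ _))//.
  by apply: ler_sum => i _; rewrite normrM (ger0_norm (P_ge0 _ _ _)).
by rewrite ltr_pdivrMr.
Unshelve. all: by end_near. Qed.

Variables (d F : S -> R).
Hypothesis FE : forall s', F s' = d s' + gamma * \sum_s F s * P w s s'.

(* [F (I - gamma P_w) = d] turns the increment of [d h] into
   [F (Delta r + gamma (Delta P) h_x)], so that continuity of [h] suffices. *)
Lemma discounted_value_first_order :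
  first_order (fun x => \sum_s d s * h x s) w
    (fun i => \sum_s F s * (Dr s i + gamma * \sum_s' DP s s' i * h w s')).
Proof.
(* The factor [* 1] gives the reward increment the same shape [(f x - f w) * g x] as the kernel
   increments. *)
have -> : (fun x => \sum_s d s * h x s) = (fun x => \sum_s d s * h w s +
    \sum_s F s * ((r x s - r w s) * 1 + gamma * \sum_s' (P x s s' - P w s s') * h x s')).
  apply/funext => x.
  rewrite [LHS](sum_discounted_occupancy (h x) FE).
  rewrite [X in _ = X + _](sum_discounted_occupancy (h w) FE).
  rewrite -big_split/=; apply: eq_bigr => s _.
  rewrite -mulrDr {1}hE (hE w s).
  have -> : \sum_s' (P x s s' - P w s s') * h x s' =
      \sum_s' P x s s' * h x s' - \sum_s' P w s s' * h x s'.
    by rewrite -sumrB; apply: eq_bigr => s' _; rewrite mulrBl.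
  by congr (_ * _); ring.
pose G i := 0 + \sum_s F s * (Dr s i * 1 + gamma * \sum_s' DP s s' i * h w s').
rewrite [X in first_order _ _ X](_ : _ = G); last first.
  by apply/funext => i; rewrite /G add0r; under [RHS]eq_bigr do rewrite mulr1.
apply: first_orderD; first exact: first_order_cst.
apply: (@first_order_sum _ _ S
  (fun s x => F s * ((r x s - r w s) * 1 +
    gamma * \sum_s' (P x s s' - P w s s') * h x s')) w
  (fun s i => F s * (Dr s i * 1 + gamma * \sum_s' DP s s' i * h w s'))) => s.
apply: first_orderZ; apply: first_orderD.
  by apply: (@first_orderM_continuous _ _ _ (cst 1)); [exact: r_diff|exact: cst_continuous].
apply: first_orderZ.
apply: (@first_order_sum _ _ S (fun s' x => (P x s s' - P w s s') * h x s') w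
  (fun s' i => DP s s' i * h w s')) => s'.
apply: (@first_orderM_continuous _ _ _ (h ^~ s')) => //.
exact: discounted_value_continuous.
Qed.

End discounted_value_gradient.

(** * Differentiation under the action integral *)

Section real_integrable.
Context {R : realType} {d : measure_display} {T : measurableType d}.
Variable mu : {measure set T -> \bar R}.
Implicit Types f g : T -> R.

Local Notation intg f := (mu.-integrable [set: T] (EFin \o f)).

Lemma measurable_integrable f : intg f -> measurable_fun setT f.
Proof. by move=> /(@measurable_int _ _ _ mu)/measurable_EFinP. Qed.

Lemma integrable_RD f g : intg f -> intg g -> intg (fun x => f x + g x).
Proof.
by move=> fi gi; apply: eq_integrable (integrableD measurableT fi gi) => // x _.
Qed.

Lemma integrable_RZl c f : intg f -> intg (fun x => c * f x).
Proof.
by move=> fi; apply: eq_integrable (integrableZl measurableT c fi) => // x _.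
Qed.

Lemma integrable_RB f g : intg f -> intg g -> intg (fun x => f x - g x).
Proof.
move=> fi gi; rewrite (_ : (fun x => _) = fun x => f x + -1 * g x).
  by apply: integrable_RD => //; exact: integrable_RZl.
by apply/funext => x; rewrite mulN1r.
Qed.

Lemma integrable_Rsum (I : Type) (s : seq I) (f : I -> T -> R) :
  (forall i, intg (f i)) -> intg (fun x => \sum_(i <- s) f i x).
Proof.
move=> fi.
have H := @integrable_sum _ _ _ mu _ measurableT _ s predT (fun i => EFin \o f i) (fun i _ => fi i).
by apply: eq_integrable H => // x _ /=; rewrite sumEFin.
Qed.

Lemma integrable_Rle f g : measurable_fun setT f -> (forall x, `|f x| <= g x) ->
  intg g -> intg f.
Proof.
move=> mf fg gi; apply: (le_integrable measurableT _ _ gi).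
  exact/measurable_EFinP.
by move=> x _; rewrite /= lee_fin (le_trans (fg x))// ler_norm.
Qed.

Lemma Rintegral_sum (I : Type) (s : seq I) (f : I -> T -> R) :
  (forall i, intg (f i)) ->
  \int[mu]_x (\sum_(i <- s) f i x) = \sum_(i <- s) \int[mu]_x f i x.
Proof.
move=> fi; elim: s => [|i s IH].
  rewrite big_nil; under eq_Rintegral do rewrite big_nil.
  by rewrite /Rintegral integral0.
rewrite big_cons -IH -RintegralD//; last exact: integrable_Rsum.
by apply: eq_Rintegral => x _; rewrite big_cons.
Qed.

Lemma dominated_Rintegral_cvg0 (g : nat -> T -> R) (G : T -> R) :
  (forall n, measurable_fun setT (g n)) -> (forall n x, `|g n x| <= G x) -> intg G ->
  (forall x, g ^~ x @ \oo --> 0) -> (fun n => \int[mu]_x g n x) @ \oo --> 0.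
Proof.
move=> mg gG iG g0.
have mg' n : measurable_fun setT (EFin \o g n) by exact/measurable_EFinP.
have g0' : {ae mu, forall x, setT x -> (fun n => (EFin \o g n) x) @ \oo --> 0%E}.
  by apply: aeW => x _; apply: cvg_EFin; [exact: nearW|exact: g0].
have gG' : {ae mu, forall x n, setT x -> (`|(EFin \o g n) x| <= (EFin \o G) x)%E}.
  by apply: aeW => x n _; rewrite /= lee_fin.
have [_ _] := dominated_convergence measurableT mg' (measurable_cst _) g0' iG gG'.
by rewrite integral_cst// mul0e => /fine_cvg.
Qed.

End real_integrable.

(** * Control of likelihood ratios by a bounded score *)

Section log_lipschitz.
Context {R : realType} {K : nat}.
Implicit Types (q : 'cV[R]_K -> R) (w h : 'cV[R]_K).

Lemma derive_gradient q w h : differentiable q w ->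
  'D_h q w = \sum_i h i 0 * gradient q w i 0.
Proof.
move=> dq; rewrite deriveE//.
rewrite {1}[h](_ : _ = \sum_i h i 0 *: delta_mx i 0).
  by rewrite linear_sum/=; apply: eq_bigr => i _; rewrite linearZ/= mxE deriveE.
by rewrite {1}[h]matrix_sum_delta; apply: eq_bigr => i _; rewrite big_ord1.
Qed.

Lemma differentiable_ln_comp q w : differentiable q w -> 0 < q w ->
  differentiable (fun x => ln (q x)) w.
Proof.
move=> dq q0; apply: (@differentiable_comp _ _ _ _ q (@ln R)) => //.
by apply/derivable1_diffP; have [] := is_derive1_ln q0.
Qed.

Lemma gradient_ln_comp q w i : differentiable q w -> 0 < q w ->
  gradient q w i 0 = q w * gradient (fun x => ln (q x)) w i 0.
Proof.
move=> dq q0; rewrite !mxE !deriveE//; last exact: differentiable_ln_comp.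
have dl : differentiable (@ln R) (q w).
  by apply/derivable1_diffP; have [] := is_derive1_ln q0.
rewrite (@diff_comp _ _ _ _ q (@ln R))//= diff1E//.
have [_ /=] := is_derive1_ln q0; rewrite derive1E => ->.
by rewrite /= mulrCA divff ?mulr1// gt_eqF.
Qed.

(** Mean value theorem on the segment from w to [h + w]. The factor K appears because the norm is
    the sup norm, while the directional derivative sums K entries. *)
Lemma ln_increment_bound q C w h : (forall x, differentiable q x) ->
  (forall x, 0 < q x) ->
  (forall x, `|gradient (fun y => ln (q y)) x| <= C) ->
  `|ln (q (h + w)) - ln (q w)| <= K%:R * C * `|h|.
Proof.
move=> dq q0 qC; pose l x := ln (q x); pose g (t : R) := l (t *: h + w).
have dl x : differentiable l x by apply: differentiable_ln_comp.
(* The difference quotient of g at t is literally that of l at [t *: h + w] in the direction h, so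
   the derivative of g is read off as a directional derivative of l. *)
have E (t : R) : (fun s : R => s^-1 *: (g (s *: 1 + t) - g t)) =
          (fun s : R => s^-1 *: (l (s *: h + (t *: h + w)) - l (t *: h + w))).
  apply/funext => s; rewrite /g; congr (_ *: (l _ - _)).
  by rewrite scalerDl addrA scaler1.
have gd (t : R) : is_derive t 1 g ('D_h l (t *: h + w)).
  split; last by rewrite /derive E.
  by rewrite /derivable E; apply: diff_derivable.
have [t _] : exists2 c, c \in `]0, 1[ & g 1 - g 0 = 'D_h l (c *: h + w) * (1 - 0).
  apply: (@MVT _ g (fun t => 'D_h l (t *: h + w)) 0 1) => //.
  apply: derivable_within_continuous => t _.
  by have [] := gd t.
rewrite /g scale1r scale0r add0r subr0 mulr1 /l => ->.
rewrite derive_gradient// (le_trans (ler_norm_sum _ _ _))//.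
rewrite -mulrA -[K in K%:R]card_ord mulr_natl -sumr_const.
apply: ler_sum => i _; rewrite normrM mulrC ler_pM ?mx_entry_le_norm//.
by rewrite (le_trans (mx_entry_le_norm _ _ _)).
Qed.

(** After factoring out [expR a], everything follows from [1 + y <= expR y] at y = x and y = - x: it
    gives [expR x - 1 <= x * expR x] and [1 - expR (- x) <= x <= x * expR x]. *)
Lemma expR_increment (a b x : R) : `|b - a| <= x -> `|expR b - expR a| <= x * expR x * expR a.
Proof.
move=> ba; rewrite -[b](subrK a); move: ba; set y := b - a => yx.
have x0 : 0 <= x by apply: le_trans yx.
rewrite expRD -{2}[expR a]mul1r -mulrBl normrM [`|expR a|]ger0_norm ?expR_ge0//.
rewrite ler_wpM2r ?expR_ge0//.
move: yx; rewrite ler_norml => /andP[yl yr].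
have h1 := expR_ge1Dx (- x).
have h2 : expR (- x) * expR x = 1 by rewrite -expRD addNr expR0.
have h3 := expR_gt0 x.
have h4 : expR x - 1 <= x * expR x.
  have : (1 - x) * expR x <= expR (- x) * expR x by rewrite ler_pM2r.
  by rewrite h2; lra.
have h5 : expR y <= expR x by rewrite ler_expR.
have h6 : expR (- x) <= expR y by rewrite ler_expR.
have h7 : 1 <= expR x by rewrite (le_trans _ (expR_ge1Dx x))// lerDl.
have h8 : x <= x * expR x by rewrite ler_peMr.
by rewrite ler_norml; apply/andP; split; lra.
Qed.

Lemma likelihood_increment_bound q C w x : (forall x, differentiable q x) ->
  (forall x, 0 < q x) ->
  (forall x, `|gradient (fun y => ln (q y)) x| <= C) ->
  `|q x - q w| <= K%:R * C * `|x - w| * expR (K%:R * C * `|x - w|) * q w.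
Proof.
move=> dq q0 qC; have := @ln_increment_bound q C w (x - w) dq q0 qC.
by rewrite subrK => /expR_increment; rewrite !lnK ?posrE.
Qed.

End log_lipschitz.

Section differentiation_under_integral.
Context {R : realType} {K : nat} {d : measure_display} {A : measurableType d}.
Variable mu : {measure set A -> \bar R}.
Variables (q : 'cV[R]_K -> A -> R) (C : R).
Hypotheses (q_diff : forall a w, differentiable (q ^~ a) w)
  (q_gt0 : forall w a, 0 < q w a)
  (q_meas : forall w, measurable_fun setT (q w)).

Definition log_gradient w a : 'cV[R]_K := gradient (fun x => ln (q x a)) w.

Hypothesis q_bound : forall w a, `|log_gradient w a| <= C.

Local Notation intg f := (mu.-integrable [set: A] (EFin \o f)).

(** A partial derivative in w is a pointwise limit of difference quotients along the nonzero null
    sequence [harmonic], and each quotient is measurable in the action. *)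
Lemma measurable_log_gradient w i : measurable_fun setT (fun a => log_gradient w a i 0).
Proof.
pose e := delta_mx i 0 : 'cV[R]_K.
apply: (@measurable_fun_cvg _ _ _ _ (fun n a =>
  (@harmonic R n)^-1 * (ln (q (harmonic n *: e + w) a) - ln (q w a)))).
  move=> n; apply: measurable_funM => //.
  by apply: measurable_funB; apply: (measurableT_comp (@measurable_ln R)).
move=> a _; rewrite mxE.
have /cvg_ex[l Hl] : derivable (fun x => ln (q x a)) w e.
  by apply: diff_derivable; exact: differentiable_ln_comp.
rewrite /derive (cvg_lim _ Hl)//.
have := (cvgr_dnbhsP (fun h : R => h^-1 *: (ln (q (h *: e + w) a) - ln (q w a))) 0 l).1 Hl.
apply; split; last exact: cvg_harmonic.
by move=> n; rewrite gt_eqF// harmonic_gt0.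
Qed.

Variables (w : 'cV[R]_K) (c : A -> R).
Hypotheses (c_meas : measurable_fun setT c) (c_int : intg (fun a => q w a * c a)).

(** The likelihood ratio [q x a / q w a] is at most B uniformly in a, so what is integrable against
    the policy at w is integrable against the policy at x. *)
Lemma integrable_policy_shift x : intg (fun a => q x a * c a).
Proof.
pose B := K%:R * C * `|x - w| * expR (K%:R * C * `|x - w|) + 1.
apply: (@integrable_Rle _ _ _ _ _ (fun a => B * `|q w a * c a|)).
- exact: measurable_funM.
- move=> a; rewrite !normrM mulrA ler_wpM2r// !(ger0_norm (ltW (q_gt0 _ _))).
  have := likelihood_increment_bound w x (q_diff a) (q_gt0^~ a) (q_bound^~ a).
  by rewrite ler_norml => /andP[_]; rewrite /B mulrDl mul1r lerBlDr.
- apply: integrable_RZl; exact: (integrable_abse c_int).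
Qed.

Lemma integrable_log_gradient i : intg (fun a => q w a * log_gradient w a i 0 * c a).
Proof.
apply: (@integrable_Rle _ _ _ _ _ (fun a => C * `|q w a * c a|)).
- apply: measurable_funM => //; apply: measurable_funM => //.
  exact: measurable_log_gradient.
- move=> a; rewrite mulrAC normrM mulrC ler_wpM2r//.
  by rewrite (le_trans (mx_entry_le_norm _ _ _)).
- apply: integrable_RZl; exact: (integrable_abse c_int).
Qed.

Lemma first_order_policy a : first_order (q ^~ a) w (fun i => q w a * log_gradient w a i 0).
Proof.
move=> e e0.
have /diffE := q_diff a w; rewrite lim_id// => dE.
have : q ^~ a = (fun y => q w a + 'd (q ^~ a) w (y - w)) +o_w (fun y => y - w).
  by apply/funext => y; exact: dE.
move=> /eqaddoP/(_ e e0); apply: filterS => x; rewrite !fctE opprD addrA.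
rewrite (_ : 'd (q ^~ a) w (x - w) = \sum_i (x - w) i 0 * (q w a * log_gradient w a i 0))//.
rewrite -deriveE// derive_gradient//; apply: eq_bigr => i _.
by rewrite gradient_ln_comp.
Qed.

Let remainder x a : R := q x a - q w a - \sum_i (x - w) i 0 * (q w a * log_gradient w a i 0).

(** The restriction [|x - w| <= 1] turns the exponential factor of the likelihood bound into a
    constant. The two summands pay for the increment of q and for its linear part; being
    proportional to [|x - w|], the bound survives division by it. *)
Let remainder_bound x a : `|x - w| <= 1 ->
  `|remainder x a| <= (K%:R * C * expR (K%:R * C) + K%:R * C) * q w a * `|x - w|.
Proof.
move=> x1; have C0 : 0 <= C by apply: le_trans (q_bound w point).
have KC0 : 0 <= K%:R * C by rewrite mulr_ge0.
have q0 := ltW (q_gt0 w a).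
rewrite (le_trans (ler_normB _ _))// mulrDl mulrDl; apply: lerD.
  apply: le_trans (likelihood_increment_bound w x (q_diff a) (q_gt0^~ a) (q_bound^~ a)) _.
  rewrite [leRHS](_ : _ = K%:R * C * `|x - w| * expR (K%:R * C) * q w a); last by ring.
  rewrite ler_wpM2r// ler_wpM2l ?mulr_ge0// ler_expR.
  by rewrite ler_piMr.
rewrite (le_trans (ler_norm_sum _ _ _))// -!mulrA -[K in K%:R]card_ord mulr_natl -sumr_const.
apply: ler_sum => i _; rewrite !normrM (ger0_norm q0).
rewrite [leRHS](_ : _ = `|x - w| * (q w a * C)); last by ring.
rewrite ler_pM ?mulr_ge0 ?mx_entry_le_norm//.
by rewrite ler_wpM2l// (le_trans (mx_entry_le_norm _ _ _)).
Qed.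

(** Dominated convergence is about sequences, so the expansion is proved by contradiction along a
    sequence [u n] tending to w at which it fails. The remainders divided by [|u n - w|] tend to 0
    pointwise by [first_order_policy] and are dominated by a multiple of [|q w a * c a|]. *)
Lemma first_order_integral :
  first_order (fun x => \int[mu]_a (q x a * c a)) w
    (fun i => \int[mu]_a (q w a * log_gradient w a i 0 * c a)).
Proof.
move=> e e0; pose P x := `|\int[mu]_a (q x a * c a) - \int[mu]_a (q w a * c a) -
    \sum_i (x - w) i 0 * \int[mu]_a (q w a * log_gradient w a i 0 * c a)| <=
  e * `|x - w|.
change (nbhs w P); apply: contrapT => notnear.
have /choice[u uP] n : exists x, `|x - w| < @harmonic R n /\ ~ P x.
  apply: contrapT => H; apply: notnear.
  apply/nbhs_ballP; exists (harmonic n) => /=; first exact: harmonic_gt0.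
  move=> y; rewrite -ball_normE /= => wy; apply: contrapT => Py; apply: H; exists y.
  by rewrite distrC.
have u1 n : `|u n - w| <= 1.
  have [/ltW/le_trans + _] := uP n; apply.
  by rewrite /harmonic/= invf_le1 ?ler1n.
have u0 : u @ \oo --> w.
  apply/cvgrPdist_lt => e' e'0; near=> n.
  have [+ _] := uP n; rewrite distrC => /lt_trans; apply.
  near: n; have /cvgr0Pnorm_lt/(_ _ e'0) := @cvg_harmonic R.
  by apply: filterS => n; rewrite ger0_norm// harmonic_ge0.
have mrem x : measurable_fun setT (remainder x).
  apply: measurable_funB; first exact: measurable_funB.
  apply: measurable_sum => i; apply: measurable_funM => //.
  by apply: measurable_funM => //; exact: measurable_log_gradient.
(* When [u n = w] the convention that the inverse of 0 is 0 makes [g n] vanish, which keeps the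
   bound and the limit valid there. *)
pose g n a := `|u n - w|^-1 * (`|remainder (u n) a| * `|c a|).
have g_bound n a : `|g n a| <= (K%:R * C * expR (K%:R * C) + K%:R * C) * `|q w a * c a|.
  rewrite /g !normrM !normr_id normfV normr_id.
  have [->|uw] := eqVneq (u n) w.
    rewrite subrr normr0 invr0 mul0r mulr_ge0// addr_ge0// ?mulr_ge0// ?expR_ge0//;
    by apply: le_trans (q_bound w point).
  have uw0 : 0 < `|u n - w| by rewrite normr_gt0 subr_eq0.
  rewrite mulrA [leRHS]mulrA ler_wpM2r// (ger0_norm (ltW (q_gt0 _ _))).
  by rewrite mulrC ler_pdivrMr// remainder_bound.
have g_cvg a : (fun n => g n a) @ \oo --> 0.
  apply/cvgr0Pnorm_le => e' e'0.
  have ca : 0 < `|c a| + 1 by rewrite ltr_wpDl.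
  have /u0 := @first_order_policy a _ (divr_gt0 e'0 ca).
  rewrite /nbhs/=; apply: (@filterS _ \oo) => n /= H.
  rewrite /g normrM [`|_ * `|c a| |]ger0_norm ?mulr_ge0// normfV normr_id.
  have [->|uw] := eqVneq (u n) w.
    by rewrite subrr normr0 invr0 mul0r ltW.
  have uw0 : 0 < `|u n - w| by rewrite normr_gt0 subr_eq0.
  rewrite mulrC ler_pdivrMr// (le_trans (ler_wpM2r _ H))//.
  rewrite mulrAC ler_wpM2r// mulrAC -mulrA ger_pMr// ler_pdivrMr// mul1r.
  by rewrite lerDl.
have mg n : measurable_fun setT (g n).
  by apply: measurable_funM => //; apply: measurable_funM; exact: measurableT_comp.
have gi n : intg (g n).
  apply: (integrable_Rle (mg n) (g_bound n)).
  by apply: integrable_RZl; exact: (integrable_abse c_int).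
have := @dominated_Rintegral_cvg0 _ _ _ mu _ _ mg g_bound _ g_cvg.
(* One index N with integral below e is enough: the failure of [P (u N)] forces that same integral
   to be at least e. *)
move=> /(_ (integrable_RZl _ (integrable_abse c_int)))/cvgr0Pnorm_lt/(_ e e0)[N _ /(_ N)].
move=> /(_ (leqnn _)) /=; apply/negP; rewrite -leNgt.
have [_ /negP] := uP N; rewrite -ltNge.
have [->|uw] := eqVneq (u N) w.
  rewrite !subrr sub0r normrN big1 => [|i _]; last by rewrite mxE mul0r.
  by rewrite !normr0 mulr0 ltxx.
have uw0 : 0 < `|u N - w| by rewrite normr_gt0 subr_eq0.
move=> /ltW; rewrite -ler_pdivlMr// => /le_trans; apply.
have ri : intg (fun a => remainder (u N) a * c a).
  apply: (@integrable_Rle _ _ _ _ _ (fun a => `|u N - w| * g N a)).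
  - exact: measurable_funM.
  - by move=> a; rewrite /g mulrA divff ?gt_eqF// mul1r normrM.
  - exact: integrable_RZl.
have -> : \int[mu]_a (q (u N) a * c a) - \int[mu]_a (q w a * c a) -
    \sum_i (u N - w) i 0 * \int[mu]_a (q w a * log_gradient w a i 0 * c a) =
    \int[mu]_a (remainder (u N) a * c a).
  under eq_bigr do rewrite -RintegralZl ?integrable_log_gradient//.
  rewrite -Rintegral_sum; last first.
    by move=> i; apply: integrable_RZl; exact: integrable_log_gradient.
  rewrite -RintegralB ?integrable_policy_shift// -RintegralB//.
  - apply: eq_Rintegral => a _; rewrite /remainder [RHS]mulrBl mulrBl mulr_suml.
    by congr (_ - _); apply: eq_bigr => i _; rewrite !mulrA.
  - by apply: integrable_RB => //; exact: integrable_policy_shift.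
  - by apply: integrable_Rsum => i; apply: integrable_RZl; exact: integrable_log_gradient.
rewrite ler_pdivrMr// (le_trans (le_normr_Rintegral _ _))//.
rewrite (ger0_norm (Rintegral_ge0 _ _)) => [|a _]; last by rewrite /g !mulr_ge0.
rewrite mulrC -RintegralZl//; apply: le_Rintegral => //.
- exact: (integrable_abse ri).
- exact: integrable_RZl.
- by move=> a _; rewrite /g mulrA divff ?gt_eqF// mul1r normrM.
Unshelve. all: by end_near. Qed.

End differentiation_under_integral.

(** * Conditioning on the past of the trajectory *)

Section weighted_integral.
Context {R : realType} {d d' : measure_display}.
Context {T : measurableType d} {U : measurableType d'}.
Variables (m : {measure set T -> \bar R}) (k : T -> R) (f : T -> U).
Hypotheses (k_ge0 : forall x, 0 <= k x) (k_meas : measurable_fun setT k)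
  (f_meas : measurable_fun setT f).

Import HBNNSimple.

(** The simple functions and the values y depend on phi only; m, k and f enter through integrals of
    indicators. Two weighted measures agreeing on indicators therefore give the same limit. *)
Lemma weighted_integral_lim (phi : U -> R) (mphi : measurable_fun setT (EFin \o phi)) :
  (forall u, 0 <= phi u) ->
  let h n := nnsfun_approx measurableT mphi n in
  (\int[m]_x (k x * phi (f x))%:E = limn (fun n => \sum_(y \in range (h n))
     y%:E * \int[m]_x (k x * \1_(h n @^-1` [set y]) (f x))%:E))%E.
Proof.
move=> phi0 h.
have mh n : measurable_fun setT (fun x => h n (f x)).
  by apply: measurableT_comp f_meas; exact: measurable_funP.
have hphi u : (EFin \o (h ^~ u)) @ \oo --> (phi u)%:E.
  by apply: (@cvg_nnsfun_approx _ _ _ _ measurableT _ mphi) => // ? _ /=; rewrite lee_fin.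
have -> : (\int[m]_x (k x * phi (f x))%:E =
    \int[m]_x limn (fun n => (k x * h n (f x))%:E))%E.
  apply: eq_integral => x _; apply/esym/cvg_lim => //.
  rewrite EFinM; under eq_fun do rewrite EFinM.
  by apply: cvgeZl => //; exact: hphi.
rewrite monotone_convergence//; last first.
- move=> x _ a b ab; rewrite lee_fin ler_wpM2l//.
  exact/lefP/nd_nnsfun_approx.
- by move=> n x _; rewrite lee_fin mulr_ge0.
- by move=> n; apply/measurable_EFinP; exact: measurable_funM.
congr (limn _); apply/funext => n.
have mi y : measurable_fun setT (fun x => \1_(h n @^-1` [set y]) (f x) : R).
  apply: measurableT_comp f_meas; apply: measurable_indic.
  by rewrite -[X in measurable X]setTI; apply: measurable_funP => //.
transitivity (\int[m]_x (\sum_(y \in range (h n))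
    y%:E * (k x * \1_(h n @^-1` [set y]) (f x))%:E))%E.
  apply: eq_integral => x _; rewrite fimfunE EFinM -fsumEFin// ge0_mule_fsumr.
    by apply: eq_fsbigr => y _; rewrite -!EFinM mulrCA.
  by move=> y; exact: nnfun_muleindic_ge0.
rewrite ge0_integral_fsum//.
- apply: eq_fsbigr => y; rewrite inE => -[u _ <-].
  rewrite ge0_integralZl//.
  + by apply/measurable_EFinP; exact: measurable_funM.
  + by move=> x _; rewrite lee_fin mulr_ge0.
  + by rewrite lee_fin.
- move=> y; apply: measurable_funeM; apply/measurable_EFinP.
  exact: measurable_funM.
- move=> y x _; rewrite -EFinM lee_fin mulrCA mulr_ge0//.
  by have := nnfun_muleindic_ge0 (h n) y (f x); rewrite lee_fin.
Qed.

End weighted_integral.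

Section weighted_integral_eq.
Context {R : realType} {d1 d2 d' : measure_display}.
Context {T1 : measurableType d1} {T2 : measurableType d2} {U : measurableType d'}.
Variables (m1 : {measure set T1 -> \bar R}) (k1 : T1 -> R) (f1 : T1 -> U).
Variables (m2 : {measure set T2 -> \bar R}) (k2 : T2 -> R) (f2 : T2 -> U).
Hypotheses (k1_ge0 : forall x, 0 <= k1 x) (k1_meas : measurable_fun setT k1)
  (f1_meas : measurable_fun setT f1).
Hypotheses (k2_ge0 : forall x, 0 <= k2 x) (k2_meas : measurable_fun setT k2)
  (f2_meas : measurable_fun setT f2).
Hypothesis eq_indic : forall B, measurable B ->
  (\int[m1]_x (k1 x * \1_B (f1 x))%:E = \int[m2]_y (k2 y * \1_B (f2 y))%:E)%E.

Import HBNNSimple.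

(** Both sides integrate phi against the image of a measure with density. It serves in two ways:
    with U the action space, to identify the law of an action, and with U a space [past i j] and
    both maps the identity, to compare conditional expectations. *)
Lemma ge0_weighted_integral_eq (phi : U -> R) : measurable_fun setT phi ->
  (forall u, 0 <= phi u) ->
  (\int[m1]_x (k1 x * phi (f1 x))%:E = \int[m2]_y (k2 y * phi (f2 y))%:E)%E.
Proof.
move=> /measurable_EFinP mphi phi0.
rewrite (weighted_integral_lim m1 k1_ge0 k1_meas f1_meas mphi)//.
rewrite (weighted_integral_lim m2 k2_ge0 k2_meas f2_meas mphi)//.
congr (limn _); apply/funext => n; apply: eq_fsbigr => y _; rewrite eq_indic//.
Qed.

(** Valid in the extended reals without integrability of phi, because positive and negative parts
    are matched separately. Integrability can thus be deduced from such an equality afterwards. *)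
Lemma weighted_integral_eq (phi : U -> R) : measurable_fun setT phi ->
  (\int[m1]_x (k1 x * phi (f1 x))%:E = \int[m2]_y (k2 y * phi (f2 y))%:E)%E.
Proof.
move=> mphi; rewrite integralE [RHS]integralE.
have posE (T : Type) (k : T -> R) (f : T -> U) : (forall x, 0 <= k x) ->
    ((fun x => (k x * phi (f x))%:E)^\+ =
      fun x => (k x * Num.max (phi (f x)) 0)%:E)%E.
  move=> k0; apply/funext => x.
  by rewrite funeposE -EFin_max maxr_pMr// mulr0.
have negE (T : Type) (k : T -> R) (f : T -> U) : (forall x, 0 <= k x) ->
    ((fun x => (k x * phi (f x))%:E)^\- =
      fun x => (k x * Num.max (- phi (f x)) 0)%:E)%E.
  move=> k0; apply/funext => x.
  by rewrite funenegE -EFinN -EFin_max maxr_pMr// mulr0 mulrN.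
rewrite !posE// !negE//; congr (_ - _)%E.
- apply: (@ge0_weighted_integral_eq (fun u => Num.max (phi u) 0)).
    exact: measurable_maxr.
  by move=> u; rewrite le_max lexx orbT.
- apply: (@ge0_weighted_integral_eq (fun u => Num.max (- phi u) 0)).
    by apply: measurable_maxr => //; exact: measurable_funN.
  by move=> u; rewrite le_max lexx orbT.
Qed.

End weighted_integral_eq.

(** * The sigma-algebras generated by the past *)

Section history.
Context {R : realType} {S : finType} {dA dO : measure_display}
  {A : measurableType dA} {Omega : measurableType dO}.
Variables (St : nat -> Omega -> S) (At : nat -> Omega -> A).

Definition history_gen (i j : nat) : set (set Omega) :=
  [set E | (exists t s, (t < i)%N /\ E = St t @^-1` [set s]) \/
           (exists t B, [/\ (t < j)%N, measurable B & E = At t @^-1` B])].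

(* [Omega] carrying the sigma-algebra of the history, so that measurability of
   a function on [past i j] means that it depends on
   s_0, ..., s_(i-1), a_0, ..., a_(j-1) only. *)
Definition past i j := g_sigma_algebraType (history_gen i j).

HB.instance Definition _ i j := Measurable.on (past i j).

Lemma measurable_past_state i j t s : (t < i)%N ->
  measurable (St t @^-1` [set s] : set (past i j)).
Proof. by move=> ti; apply: sub_gen_smallest; left; exists t, s. Qed.

Lemma measurable_past_action i j t : (t < j)%N ->
  measurable_fun setT (At t : past i j -> A).
Proof.
move=> tj _ B mB; rewrite setTI.
by apply: sub_gen_smallest; right; exists t, B.
Qed.

Lemma measurable_past_indicator i j t s : (t < i)%N ->
  measurable_fun setT ((fun o => (St t o == s)%:R) : past i j -> R).
Proof.
move=> ti.
have -> : (fun o => (St t o == s)%:R) = (\1_(St t @^-1` [set s]) : past i j -> R).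
  apply/funext => o; rewrite indicE; congr ((nat_of_bool _)%:R).
  by apply/idP/idP => [/eqP so|/set_mem/= /eqP//]; rewrite mem_set.
by apply: measurable_indic; exact: measurable_past_state.
Qed.

Lemma measurable_past_fun i j t (c : S -> A -> R) : (t < i)%N -> (t < j)%N ->
  (forall s, measurable_fun setT (c s)) ->
  measurable_fun setT ((fun o => c (St t o) (At t o)) : past i j -> R).
Proof.
move=> ti tj mc.
(* Measurability of c is known in the action for each fixed state; splitting over the finitely many
   states reduces to that. *)
have -> : (fun o => c (St t o) (At t o)) =
    (fun o => \sum_s (St t o == s)%:R * c s (At t o)).
  apply/funext => o; rewrite (bigD1 (St t o))//= eqxx mul1r big1 ?addr0// => s.
  by rewrite eq_sym => /negbTE ->; rewrite mul0r.
apply: measurable_sum => s; apply: measurable_funM.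
  exact: measurable_past_indicator.
by apply: measurableT_comp => //; exact: measurable_past_action.
Qed.

Lemma measurable_past_widen i j i' j' (X : Omega -> R) : (i <= i')%N -> (j <= j')%N ->
  measurable_fun setT (X : past i j -> R) -> measurable_fun setT (X : past i' j' -> R).
Proof.
move=> ii jj mX _ B mB.
have : <<s history_gen i j >> `<=` <<s history_gen i' j' >>.
  apply: smallest_sub; first exact: smallest_sigma_algebra.
  move=> E [[t [s [ti ->]]]|[t [C [tj mC ->]]]]; apply: sub_gen_smallest.
    by left; exists t, s; split=> //; exact: leq_trans ii.
  by right; exists t, C; split=> //; exact: leq_trans jj.
by apply; exact: mX.
Qed.

Hypotheses (St_meas : forall t s, measurable (St t @^-1` [set s]))
  (At_meas : forall t, measurable_fun setT (At t)).

Lemma measurable_past_id i j : measurable_fun setT (id : Omega -> past i j).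
Proof.
move=> _ B; rewrite setTI preimage_id; apply: smallest_sub.
  by split; [exact: measurable0|move=> C mC; rewrite setTD; exact: measurableC|exact: bigcupT_measurable].
move=> E [[t [s [_ ->]]]|[t [C [_ mC ->]]]]//.
by rewrite -[X in measurable X]setTI; exact: At_meas.
Qed.

Lemma measurable_past i j (X : Omega -> R) :
  measurable_fun setT (X : past i j -> R) -> measurable_fun setT X.
Proof.
move=> mX; apply: (@measurableT_comp _ _ _ _ _ _ (X : past i j -> R) setT
  (id : Omega -> past i j) mX); exact: measurable_past_id.
Qed.

End history.

(** * Integrating out one action and one transition *)

Section transition.
Context {R : realType} {S : finType} {dA dO : measure_display}
  {A : measurableType dA} {Omega : measurableType dO}.
Variables (mu : {sigma_finite_measure set A -> \bar R}) (M : mdp R S A)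
  (Pr : probability Omega R) (d : S -> R) (pb : S -> A -> R)
  (St : nat -> Omega -> S) (At : nat -> Omega -> A).
Hypotheses (pb_policy : is_policy mu pb)
  (traj : is_trajectory Pr mu M d pb St At).

Local Notation past := (past St At).

Let St_meas := traj_measurable_state traj.
Let At_meas := traj_measurable_action traj.
Let pb_meas s : measurable_fun setT (pb s). Proof. by have [] := pb_policy s. Qed.
Let pb_ge0 s a : 0 <= pb s a. Proof. by have [] := pb_policy s. Qed.

Lemma state_indicatorE t s : (fun o => ((St t o == s)%:R : R)) = \1_(St t @^-1` [set s]).
Proof.
apply/funext => o; rewrite indicE; congr ((nat_of_bool _)%:R).
by apply/idP/idP => [/eqP so|/set_mem/= /eqP//]; rewrite mem_set.
Qed.

Lemma measurable_state_indicator t s :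
  measurable_fun setT (fun o => ((St t o == s)%:R : R)).
Proof. by rewrite state_indicatorE; exact: measurable_indic. Qed.

Let past_measurable i j H : history St At i j H -> measurable H.
Proof.
move=> hH; rewrite -[H]setTI -[H]preimage_id.
exact: (@measurable_past_id _ _ _ _ _ St At St_meas At_meas i j measurableT H hH).
Qed.

Lemma integral_action t s H (phi : A -> R) : history St At t.+1 t H ->
  measurable_fun setT phi -> (forall a, 0 <= phi a) ->
  (\int[Pr]_o ((\1_H o * (St t o == s)%:R) * phi (At t o))%:E =
   Pr (H `&` St t @^-1` [set s]) * \int[mu]_a (pb s a * phi a)%:E)%E.
Proof.
move=> hH mphi phi0; set H' := H `&` _.
have hH' : history St At t.+1 t H'.
  have : measurable (H' : set (past t.+1 t)).
    by apply: measurableI => //; exact: measurable_past_state.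
  by [].
have mH' : measurable H' by exact: past_measurable hH'.
have PrH' : Pr H' \is a fin_num by rewrite fin_num_measure.
have kE : (fun o => \1_H o * (St t o == s)%:R) = \1_H' :> (Omega -> R).
  have := state_indicatorE t s => /(congr1 (fun f => fun o => \1_H o * f o)) ->.
  by rewrite /H' indicI.
transitivity (\int[mu]_a ((fine (Pr H') * pb s a) * phi (id a))%:E)%E; last first.
  rewrite -[in RHS](fineK PrH') -ge0_integralZl//.
  - by apply: eq_integral => a _; rewrite -EFinM mulrA.
  - by apply/measurable_EFinP; exact: measurable_funM.
  - by move=> a _; rewrite lee_fin mulr_ge0.
  - by rewrite lee_fin fine_ge0.
apply: (@ge0_weighted_integral_eq _ _ _ _ _ _ _ Pr
   (fun o => \1_H o * (St t o == s)%:R) (At t) mu (fun a => fine (Pr H') * pb s a) id) => //.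
- by rewrite kE; exact: measurable_indic.
- by move=> a; rewrite mulr_ge0// fine_ge0.
- exact: measurable_funM.
move=> B mB.
transitivity (Pr (H' `&` At t @^-1` B)).
  rewrite -(setIT (H' `&` _)) -integral_indic//; last first.
    by apply: measurableI => //; rewrite -[X in measurable X]setTI; exact: At_meas.
  apply: eq_integral => o _; rewrite indicI/= -kE.
  by [].
rewrite (traj_action traj hH' mB).
(* On [H'] the state is s, so the inner integral over actions is a constant. *)
transitivity (\int[Pr]_(o in H') (cst (\int[mu]_(a in B) (pb s a)%:E) o))%E.
  by apply: eq_integral => o; rewrite inE => -[_ /= ->].
rewrite integral_cst//.
transitivity (\int[mu]_a ((fine (Pr H'))%:E * (pb s a * \1_B a)%:E))%E; last first.
  by apply: eq_integral => a _; rewrite -EFinM mulrA.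
rewrite ge0_integralZl//.
- rewrite fineK// muleC; congr (_ * _)%E; rewrite [LHS]integral_mkcond.
  by apply: eq_integral => a _; rewrite /= epatch_indic EFinM.
- by apply/measurable_EFinP; exact: measurable_funM.
- by move=> a _; rewrite lee_fin mulr_ge0.
- by rewrite lee_fin fine_ge0.
Qed.

(** The nonnegative phi belongs to the weight and X is the integrand, so it suffices to test on
    events B of the past, where [integral_action] applies. *)
Lemma integral_past_action t s (phi : A -> R) (X : Omega -> R) :
  measurable_fun setT phi -> (forall a, 0 <= phi a) ->
  mu.-integrable setT (EFin \o (fun a => pb s a * phi a)) ->
  measurable_fun setT (X : past t.+1 t -> R) ->
  (\int[Pr]_o (((St t o == s)%:R * phi (At t o)) * X o)%:E =
   \int[Pr]_o (((St t o == s)%:R * \int[mu]_a (pb s a * phi a)) * X o)%:E)%E.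
Proof.
move=> mphi phi0 iphi mX.
apply: (@weighted_integral_eq _ _ _ _ _ _ (past t.+1 t) Pr
  (fun o => (St t o == s)%:R * phi (At t o)) id Pr
  (fun o => (St t o == s)%:R * \int[mu]_a (pb s a * phi a)) id) => //.
- by move=> o; rewrite mulr_ge0.
- apply: measurable_funM; first exact: measurable_state_indicator.
  by apply: measurableT_comp => //; exact: At_meas.
- exact: measurable_past_id.
- by move=> o; rewrite mulr_ge0// Rintegral_ge0// => a _; rewrite mulr_ge0.
- by apply: measurable_funM => //; exact: measurable_state_indicator.
- exact: measurable_past_id.
move=> B mB /=.
transitivity (Pr (B `&` St t @^-1` [set s]) * \int[mu]_a (pb s a * phi a)%:E)%E.
  rewrite -integral_action//; apply: eq_integral => o _; congr (_%:E); ring.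
have -> : (\int[mu]_a (pb s a * phi a)%:E = (\int[mu]_a (pb s a * phi a))%:E)%E.
  by rewrite /Rintegral fineK//; exact: integrable_fin_num.
set q := \int[mu]_a (pb s a * phi a).
have mB' : dO.-measurable ((B : set Omega) `&` St t @^-1` [set s]).
  by apply: measurableI => //; exact: (@past_measurable t.+1 t).
rewrite -(setIT (_ `&` _)) -integral_indic// muleC -ge0_integralZl//.
- apply: eq_integral => o _; rewrite -EFinM indicI /=.
  have := state_indicatorE t s => /(congr1 (fun f => f o)) /= <-; congr (_%:E); ring.
- by apply/measurable_EFinP; exact: measurable_indic.
- by rewrite lee_fin Rintegral_ge0// => a _; rewrite mulr_ge0.
Qed.

Lemma integral_past_state t s' (Y : Omega -> R) :
  measurable_fun setT (Y : past t.+1 t.+1 -> R) ->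
  (\int[Pr]_o ((St t.+1 o == s')%:R * Y o)%:E =
   \int[Pr]_o (trans M (St t o) (At t o) s' * Y o)%:E)%E.
Proof.
move=> mY.
have mtr : measurable_fun setT (fun o => trans M (St t o) (At t o) s').
  apply: (@measurable_past _ _ _ _ _ _ St At St_meas At_meas t.+1 t.+1).
  apply: (@measurable_past_fun _ _ _ _ _ _ St At t.+1 t.+1 t (fun s a => trans M s a s')) => // s.
  exact: measurable_trans.
apply: (@weighted_integral_eq _ _ _ _ _ _ (past t.+1 t.+1) Pr
  (fun o => (St t.+1 o == s')%:R) id Pr
  (fun o => trans M (St t o) (At t o) s') id) => //.
- exact: measurable_state_indicator.
- exact: measurable_past_id.
- by move=> o; exact: trans_ge0.
- exact: measurable_past_id.
move=> B mB /=.
transitivity (Pr (B `&` St t.+1 @^-1` [set s'])).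
  rewrite -(setIT (_ `&` _)) -integral_indic//; last first.
    by apply: measurableI => //; exact: (@past_measurable t.+1 t.+1).
  apply: eq_integral => o _; rewrite indicI /=.
  by have := state_indicatorE t.+1 s' => /(congr1 (fun f => f o)) /= <-; rewrite mulrC.
rewrite (traj_state traj s' mB) integral_mkcond.
by apply: eq_integral => o _; rewrite /= epatch_indic EFinM.
Qed.

Local Notation intg mu f := (mu.-integrable [set: _] (EFin \o f)).

Let wgt s s' (c : A -> R) a := pb s a * trans M s a s' * c a.

(** Conditioning runs backwards in time: the indicator of the next state is replaced by [trans]
    given the past including [a_t], and then [a_t] is integrated out given the past up to [s_t]. *)
Let ge0_integral_step t s s' (c : A -> R) (X : Omega -> R) :
  measurable_fun setT c -> (forall a, 0 <= c a) -> intg mu (wgt s s' c) ->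
  measurable_fun setT (X : past t.+1 t -> R) ->
  (\int[Pr]_o ((St t o == s)%:R * (St t.+1 o == s')%:R * c (At t o) * X o)%:E =
   \int[Pr]_o (((St t o == s)%:R * \int[mu]_a wgt s s' c a) * X o)%:E)%E.
Proof.
move=> mc c0 ic mX.
have mtr : measurable_fun setT (fun a => trans M s a s') by exact: measurable_trans.
have mY : measurable_fun setT ((fun o => (St t o == s)%:R * c (At t o) * X o)
    : past t.+1 t.+1 -> R).
  apply: measurable_funM; last exact: (measurable_past_widen _ _ mX).
  apply: measurable_funM; first exact: measurable_past_indicator.
  by apply: measurableT_comp => //; exact: measurable_past_action.
have wE : wgt s s' c = fun a => pb s a * (trans M s a s' * c a).
  by apply/funext => a; rewrite /wgt mulrA.
transitivity (\int[Pr]_o ((St t.+1 o == s')%:R * ((St t o == s)%:R * c (At t o) * X o))%:E)%E.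
  by apply: eq_integral => o _; congr (_%:E); ring.
rewrite integral_past_state//.
rewrite wE -integral_past_action//; last first.
- by rewrite -wE.
- by move=> a; rewrite mulr_ge0// trans_ge0.
- exact: measurable_funM.
apply: eq_integral => o _; congr (_%:E).
by case: eqP => [->|_] /=; [ring|rewrite !(mul0r, mulr0)].
Qed.

Let ge0_step t s s' (c : A -> R) (X : Omega -> R) :
  measurable_fun setT c -> (forall a, 0 <= c a) -> intg mu (wgt s s' c) ->
  measurable_fun setT (X : past t.+1 t -> R) -> intg Pr X ->
  intg Pr (fun o => (St t o == s)%:R * (St t.+1 o == s')%:R * c (At t o) * X o) /\
  \int[Pr]_o ((St t o == s)%:R * (St t.+1 o == s')%:R * c (At t o) * X o) =
  (\int[Pr]_o ((St t o == s)%:R * X o)) * \int[mu]_a wgt s s' c a.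
Proof.
move=> mc c0 ic mX iX.
have mXO : measurable_fun setT X by exact: (measurable_integrable iX).
have mI t' s1 : measurable_fun setT (fun o => ((St t' o == s1)%:R : R)).
  exact: measurable_state_indicator.
have iIX : intg Pr (fun o => (St t o == s)%:R * X o).
  apply: (@integrable_Rle _ _ _ _ _ (fun o => `|X o|)).
  - exact: measurable_funM.
  - by move=> o; case: eqP => _; rewrite ?mul1r ?mul0r ?normr0.
  - exact: (integrable_abse iX).
split; last first.
  rewrite -[RHS](RintegralZr _ _ iIX)//.
  apply: etrans (congr1 fine (ge0_integral_step mc c0 ic mX)) _.
  by apply: eq_Rintegral => o _; ring.
apply/integrableP; split.
  apply/measurable_EFinP; apply: measurable_funM => //; apply: measurable_funM.
    exact: measurable_funM.
  by apply: measurableT_comp => //; exact: At_meas.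
have mX' : measurable_fun setT ((fun o => `|X o|) : past t.+1 t -> R).
  exact: measurableT_comp.
(* The weight being nonnegative, the identity for [|X|] computes the integral of the absolute value,
   which gives integrability. *)
have E := ge0_integral_step mc c0 ic mX'.
rewrite (_ : (\int[Pr]_x _)%E = \int[Pr]_o ((St t o == s)%:R *
    (St t.+1 o == s')%:R * c (At t o) * `|X o|)%:E)%E; last first.
  apply: eq_integral => o _; rewrite /= normrM; congr ((_ * _)%:E).
  by rewrite ger0_norm// !mulr_ge0.
rewrite E.
have : intg Pr (fun o => (\int[mu]_a wgt s s' c a) * `|(St t o == s)%:R * X o|).
  by apply: integrable_RZl; exact: (integrable_abse iIX).
move=> /integrableP[_]; apply: le_lt_trans; rewrite le_eqVlt; apply/orP; left; apply/eqP.
apply: eq_integral => o _ /=; congr (_%:E).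
have q0 : 0 <= \int[mu]_a wgt s s' c a.
  by rewrite Rintegral_ge0// => a _; rewrite !mulr_ge0// trans_ge0.
rewrite !normrM !normr_id (ger0_norm q0) (ger0_norm (ler0n _ _)); ring.
Qed.

Let step t s s' (c : A -> R) (X : Omega -> R) :
  measurable_fun setT c -> intg mu (wgt s s' c) ->
  measurable_fun setT (X : past t.+1 t -> R) -> intg Pr X ->
  intg Pr (fun o => (St t o == s)%:R * (St t.+1 o == s')%:R * c (At t o) * X o) /\
  \int[Pr]_o ((St t o == s)%:R * (St t.+1 o == s')%:R * c (At t o) * X o) =
  (\int[Pr]_o ((St t o == s)%:R * X o)) * \int[mu]_a wgt s s' c a.
Proof.
move=> mc ic mX iX.
pose c1 a := Num.max (c a) 0; pose c2 a := Num.max (- c a) 0.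
have mc1 : measurable_fun setT c1 by exact: measurable_maxr.
have mc2 : measurable_fun setT c2.
  by apply: measurable_maxr => //; exact: measurable_funN.
have c10 a : 0 <= c1 a by rewrite le_max lexx orbT.
have c20 a : 0 <= c2 a by rewrite le_max lexx orbT.
have cE a : c a = c1 a - c2 a.
  by rewrite /c1 /c2; case: (lerP (c a) 0) => h; [rewrite max_l|rewrite max_r]; lra.
have mw (c' : A -> R) : measurable_fun setT c' -> measurable_fun setT (wgt s s' c').
  move=> mc'; apply: measurable_funM => //; apply: measurable_funM => //.
  exact: measurable_trans.
have iw (c' : A -> R) : measurable_fun setT c' -> (forall a, 0 <= c' a) -> (forall a, c' a <= `|c a|) ->
    intg mu (wgt s s' c').
  move=> mc' c'0 c'c; apply: (integrable_Rle (mw _ mc') _ (integrable_abse ic)) => a /=.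
  by rewrite /wgt !normrM ler_wpM2l// ger0_norm.
have ic1 : intg mu (wgt s s' c1).
  by apply: iw => // a; rewrite ge_max ler_norm normr_ge0.
have ic2 : intg mu (wgt s s' c2).
  by apply: iw => // a; rewrite ge_max -normrN ler_norm normr_ge0.
have [i1 e1] := ge0_step mc1 c10 ic1 mX iX.
have [i2 e2] := ge0_step mc2 c20 ic2 mX iX.
have -> : (fun o => (St t o == s)%:R * (St t.+1 o == s')%:R * c (At t o) * X o) =
  (fun o => (St t o == s)%:R * (St t.+1 o == s')%:R * c1 (At t o) * X o -
            (St t o == s)%:R * (St t.+1 o == s')%:R * c2 (At t o) * X o).
  by apply/funext => o; rewrite cE; ring.
split; first exact: integrable_RB.
rewrite RintegralB// e1 e2 -mulrBr; congr (_ * _); rewrite -RintegralB//.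
by apply: eq_Rintegral => a _; rewrite /wgt cE; ring.
Qed.

(** Integrability comes together with the value, and c need only be integrable for the behavior law.
    This permits rewards and importance ratios without a bound and lets the traces be treated by
    induction on time. *)
Lemma one_step t (c : S -> A -> S -> R) (X : Omega -> R) :
  (forall s s', measurable_fun setT (fun a => c s a s')) ->
  (forall s s', intg mu (fun a => pb s a * trans M s a s' * c s a s')) ->
  measurable_fun setT (X : past t.+1 t -> R) -> intg Pr X ->
  intg Pr (fun o => X o * c (St t o) (At t o) (St t.+1 o)) /\
  \int[Pr]_o (X o * c (St t o) (At t o) (St t.+1 o)) =
  \sum_s (\int[Pr]_o ((St t o == s)%:R * X o)) *
    \sum_s' \int[mu]_a (pb s a * trans M s a s' * c s a s').
Proof.
move=> mc ic mX iX.
have H s s' := step (mc s s') (ic s s') mX iX.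
have -> : (fun o => X o * c (St t o) (At t o) (St t.+1 o)) =
    (fun o => \sum_s \sum_s' (St t o == s)%:R * (St t.+1 o == s')%:R * c s (At t o) s' * X o).
  apply/funext => o; rewrite (bigD1 (St t o))//= [X in _ + X]big1 => [|s]; last first.
    by rewrite eq_sym => /negbTE ->; rewrite big1// => s' _; rewrite !mul0r.
  rewrite addr0 (bigD1 (St t.+1 o))//= [X in _ + X]big1 => [|s']; last first.
    by rewrite [_ == s']eq_sym => /negbTE ->; rewrite mulr0 !mul0r.
  by rewrite !eqxx !mul1r addr0 mulrC.
have i1 s : intg Pr (fun o => \sum_s' (St t o == s)%:R * (St t.+1 o == s')%:R * c s (At t o) s' * X o).
  by apply: integrable_Rsum => s'; have [] := H s s'.
split; first exact: integrable_Rsum.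
rewrite Rintegral_sum//; apply: eq_bigr => s _.
rewrite Rintegral_sum => [|s']; last by have [] := H s s'.
by rewrite mulr_sumr; apply: eq_bigr => s' _; have [_ ->] := H s s'.
Qed.

(** A converse of [one_step] at t = 0: the data integral restricted to a given pair of successive
    states is [d s] times the action integral, and [d s > 0] allows finiteness to be transferred. *)
Lemma integrable_transition (c : S -> A -> S -> R) s s' : 0 < d s ->
  (forall s s', measurable_fun setT (fun a => c s a s')) ->
  intg Pr (fun o => c (St 0%N o) (At 0%N o) (St 1%N o)) ->
  intg mu (fun a => pb s a * trans M s a s' * c s a s').
Proof.
move=> ds mc ic.
have mtr : measurable_fun setT (fun a => trans M s a s') by exact: measurable_trans.
have mphi : measurable_fun setT (fun a => trans M s a s' * `|c s a s'|).
  by apply: measurable_funM => //; exact: measurableT_comp.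
have mw : measurable_fun setT (fun a => pb s a * trans M s a s' * c s a s').
  by apply: measurable_funM => //; exact: measurable_funM.
apply/integrableP; split; first exact/measurable_EFinP.
have hT : history St At 1 0 setT by exact: (@measurableT _ (past 1 0)).
have mY : measurable_fun setT ((fun o => (St 0%N o == s)%:R * `|c s (At 0%N o) s'|)
    : past 1 1 -> R).
  apply: measurable_funM; first exact: measurable_past_indicator.
  apply: (@measurableT_comp _ _ _ _ _ _ (fun a => `|c s a s'|) setT
    (At 0%N : past 1 1 -> A)); last exact: measurable_past_action.
  exact: measurableT_comp.
have E : (\int[Pr]_o ((St 1%N o == s')%:R * ((St 0%N o == s)%:R * `|c s (At 0%N o) s'|))%:E =
    (d s)%:E * \int[mu]_a `|(pb s a * trans M s a s' * c s a s')%:E|)%E.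
  rewrite integral_past_state// -(traj_init traj s).
  rewrite -(setTI (St 0%N @^-1` _)).
  have -> : (\int[mu]_a `|(pb s a * trans M s a s' * c s a s')%:E| =
     \int[mu]_a (pb s a * (trans M s a s' * `|c s a s'|))%:E)%E.
    apply: eq_integral => a _; rewrite /= !normrM mulrA.
    by rewrite (ger0_norm (pb_ge0 _ _)) (ger0_norm (trans_ge0 _ _ _ _)).
  rewrite -integral_action//; last by move=> a; rewrite mulr_ge0// trans_ge0.
  apply: eq_integral => o _; congr (_%:E); rewrite indicT mul1r.
  by case: eqP => [->|_] /=; [ring|rewrite !(mul0r, mulr0)].
have : (\int[Pr]_o ((St 1%N o == s')%:R * ((St 0%N o == s)%:R * `|c s (At 0%N o) s'|))%:E < +oo)%E.
  have /integrableP[_] := ic; apply: le_lt_trans.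
  apply: ge0_le_integral => //.
  - apply/measurable_EFinP; apply: measurable_funM.
      exact: measurable_state_indicator.
    exact: (@measurable_past _ _ _ _ _ _ St At St_meas At_meas 1 1).
  - apply/measurable_EFinP; apply: measurableT_comp => //.
    exact: (measurable_integrable ic).
  - move=> o _; rewrite /= lee_fin.
    case: (eqVneq (St 1%N o) s') => [->|_]; last by rewrite mul0r.
    case: (eqVneq (St 0%N o) s) => [->|_]; last by rewrite mul0r mulr0.
    by rewrite !mul1r.
rewrite E; set I := (\int[mu]_a _)%E; move=> dI; change (I < +oo)%E.
have : (0 <= I)%E by apply: integral_ge0.
by move: I dI => [r _|+|//]; rewrite ?ltry// gt0_muley ?lte_fin.
Qed.

End transition.

(** * Off-policy expectations of the traces *)

Section lambda_free_traces.
Context {R : realType} {n K : nat}.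
Variables (gamma lambda : R) (rho : nat -> R).

(** The follow-on trace, that is, the emphasis for [lambda = 0]. *)
Fixpoint followon (t : nat) : R :=
  if t is t'.+1 then 1 + gamma * rho t' * followon t' else 1.

(** The trace z for [lambda = 0]. When g is the score of the target policy it is formally the
    gradient of [followon] in w, since the gradient of a ratio is the ratio times its score. *)
Fixpoint followon_score (g : nat -> 'cV[R]_K) (t : nat) : 'cV[R]_K :=
  if t is t'.+1 then
    (gamma * rho t') *: (followon t' *: g t' + followon_score g t')
  else 0.

Lemma emphasisE t : emphasis gamma lambda rho t = lambda + (1 - lambda) * followon t.
Proof. by elim: t => [|t IH] /=; [|rewrite IH]; ring. Qed.

Lemma f_traceE t : f_trace gamma lambda rho t = followon t.
Proof.
elim: t => [//|t IH]; rewrite [LHS]/= -/(emphasis _ _ _ t) IH emphasisE /=; ring.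
Qed.

Lemma e_trace_last (phi : nat -> 'cV[R]_n.+1) t :
  (forall u, phi u ord_max 0 = 1) ->
  e_trace gamma lambda rho phi t ord_max 0 = followon t.
Proof.
move=> phi1; elim: t => [|t IH]; first by rewrite /= !mxE phi1 mulr1.
rewrite [e_trace _ _ _ _ _]/= -/(emphasis gamma lambda rho t.+1) !mxE phi1 IH.
by rewrite emphasisE /=; ring.
Qed.

Lemma z_traceE g t :
  z_trace gamma lambda rho g t = (1 - lambda) *: followon_score g t.
Proof.
elim: t => [|t IH]; first by rewrite /= scaler0.
rewrite [LHS]/= -/(emphasis _ _ _ t) IH emphasisE /=.
by apply/colP => i; rewrite !mxE; ring.
Qed.

Lemma psi_traceE g t :
  psi_trace gamma lambda rho g t = followon t *: g t + followon_score g t.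
Proof.
elim: t => [//|t IH].
rewrite [LHS]/= -/(emphasis _ _ _ t) -/(emphasis _ _ _ t.+1).
rewrite -/(f_trace gamma lambda rho t.+1) -/(z_trace gamma lambda rho g t.+1).
(* The share [1 - lambda] coming from z and the share [lambda] coming from the previous psi add up
   to [gamma * rho t] times that psi, which is [followon_score] at the next time. *)
rewrite f_traceE z_traceE IH; rewrite -addrA; congr (_ + _).
by apply/colP => i; rewrite [followon_score g t.+1]/= !mxE; ring.
Qed.

End lambda_free_traces.

Lemma measurable_funV_gt0 {R : realType} {d : measure_display} {T : measurableType d}
    (f : T -> R) : measurable_fun setT f -> (forall x, 0 < f x) ->
  measurable_fun setT (fun x => (f x)^-1).
Proof.
move=> mf f0.
have -> : (fun x => (f x)^-1) = fun x => expR (- ln (f x)).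
  by apply/funext => x; rewrite expRN lnK// posrE.
apply: measurableT_comp; first exact: measurable_expR.
by apply: measurable_funN; apply: measurableT_comp => //; exact: measurable_ln.
Qed.

(** * Evolution of the state-wise masses of the traces *)

Section off_policy_expectations.
Context {R : realType} {S : finType} {dA dO : measure_display}
  {A : measurableType dA} {Omega : measurableType dO}.
Variables (mu : {sigma_finite_measure set A -> \bar R}) (M : mdp R S A)
  (Pr : probability Omega R) (d : S -> R) (pb q : S -> A -> R)
  (St : nat -> Omega -> S) (At : nat -> Omega -> A) (gamma : R).
Hypotheses (pb_policy : is_policy mu pb) (q_policy : is_policy mu q)
  (pb_gt0 : forall s a, 0 < pb s a)
  (traj : is_trajectory Pr mu M d pb St At)
  (d_stat : stationary_distribution (state_kernel mu M pb) d).

Local Notation past := (past St At).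
Local Notation intg mu f := (mu.-integrable [set: _] (EFin \o f)).

Let St_meas := traj_measurable_state traj.
Let At_meas := traj_measurable_action traj.
Let pb_meas s : measurable_fun setT (pb s). Proof. by have [] := pb_policy s. Qed.
Let q_meas s : measurable_fun setT (q s). Proof. by have [] := q_policy s. Qed.

Lemma trans_le1 s a s' : trans M s a s' <= 1.
Proof.
rewrite -(trans_sum1 M s a) (bigD1 s')//= lerDl sumr_ge0// => s1 _.
exact: trans_ge0.
Qed.

Lemma policy_integrable (p : S -> A -> R) s : is_policy mu p -> intg mu (p s).
Proof.
move=> /(_ s)[mp p0 p1]; apply/integrableP; split; first exact/measurable_EFinP.
under eq_integral do rewrite /= ger0_norm//.
by rewrite p1 ltry.
Qed.

Lemma integrable_policy_trans (p : S -> A -> R) s s' (c : A -> R) C : is_policy mu p ->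
  measurable_fun setT c -> (forall a, `|c a| <= C) ->
  intg mu (fun a => p s a * trans M s a s' * c a).
Proof.
move=> pp mc cC; have [mp p0 _] := pp s.
apply: (@integrable_Rle _ _ _ _ _ (fun a => C * p s a)).
- apply: measurable_funM => //; apply: measurable_funM => //.
  exact: measurable_trans.
- move=> a; rewrite !normrM (ger0_norm (p0 a)) (ger0_norm (trans_ge0 _ _ _ _)).
  rewrite mulrC ler_pM ?mulr_ge0 ?trans_ge0//.
  by rewrite ler_piMr// trans_le1.
- by apply: integrable_RZl; exact: policy_integrable.
Qed.

Lemma state_kernel_ge0 (p : S -> A -> R) s s' : is_policy mu p ->
  0 <= state_kernel mu M p s s'.
Proof.
by move=> /(_ s)[_ p0 _]; apply: Rintegral_ge0 => a _; rewrite mulr_ge0// trans_ge0.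
Qed.

Lemma state_kernel_sum1 (p : S -> A -> R) s : is_policy mu p ->
  \sum_s' state_kernel mu M p s s' = 1.
Proof.
move=> pp; rewrite -Rintegral_sum => [|s']; last first.
  have := @integrable_policy_trans p s s' (cst 1) 1 pp (measurable_cst _).
  rewrite (_ : (fun a => _) = fun a => p s a * trans M s a s'); last first.
    by apply/funext => a; rewrite /cst mulr1.
  by apply => a; rewrite normr1.
rewrite (@eq_Rintegral _ _ _ _ _ (p s)) => [|a _].
  by rewrite /Rintegral; have [_ _ ->] := pp s.
by rewrite -mulr_sumr trans_sum1 mulr1.
Qed.

(** The importance ratio cancels the behavior density, so both the integrability condition and the
    value are expressed under q although the data follow [pb]. *)
Lemma target_step t (c : S -> A -> S -> R) (X : Omega -> R) :
  (forall s s', measurable_fun setT (fun a => c s a s')) ->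
  (forall s s', intg mu (fun a => q s a * trans M s a s' * c s a s')) ->
  measurable_fun setT (X : past t.+1 t -> R) -> intg Pr X ->
  intg Pr (fun o => X o * (ratio pb St At q t o * c (St t o) (At t o) (St t.+1 o))) /\
  \int[Pr]_o (X o * (ratio pb St At q t o * c (St t o) (At t o) (St t.+1 o))) =
  \sum_s (\int[Pr]_o ((St t o == s)%:R * X o)) *
    \sum_s' \int[mu]_a (q s a * trans M s a s' * c s a s').
Proof.
move=> mc ic mX iX.
have E s a s' : pb s a * trans M s a s' * (q s a / pb s a * c s a s') =
    q s a * trans M s a s' * c s a s'.
  by field; rewrite gt_eqF.
have := @one_step _ _ _ _ _ _ mu M Pr d pb St At pb_policy traj t
  (fun s a s' => q s a / pb s a * c s a s') X.
move=> [||//|//|H1 H2].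
- move=> s s'; apply: measurable_funM => //; apply: measurable_funM => //.
  exact: measurable_funV_gt0.
- by move=> s s'; under eq_fun do rewrite E; exact: ic.
split=> //; rewrite H2; apply: eq_bigr => s _; congr (_ * _).
by apply: eq_bigr => s' _; apply: eq_Rintegral => a _.
Qed.

Lemma sum_kernel_indicator (p : S -> A -> R) (c : A -> R) s s' :
  \sum_s1 \int[mu]_a (p s a * trans M s a s1 * (c a * (s1 == s')%:R)) =
  \int[mu]_a (p s a * trans M s a s' * c a).
Proof.
rewrite (bigD1 s')//= eqxx big1 => [|s1 /negbTE ->].
  by rewrite addr0; apply: eq_Rintegral => a _; rewrite mulr1.
under eq_Rintegral do rewrite !mulr0.
by rewrite /Rintegral integral0.
Qed.

Lemma integrable_cst1 : intg Pr (cst 1).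
Proof. exact: finite_measure_integrable_cst. Qed.

Lemma state_indicator_norm t s (x : R) o : `|(St t o == s)%:R * x| <= `|x|.
Proof. by case: eqP => _; rewrite ?mul1r// mul0r normr0. Qed.

Lemma integrable_state_indicator t s (X : Omega -> R) : intg Pr X ->
  intg Pr (fun o => (St t o == s)%:R * X o).
Proof.
move=> iX; apply: (integrable_Rle _ _ (integrable_abse iX)).
  apply: measurable_funM; last exact: measurable_integrable iX.
  exact: (measurable_state_indicator traj).
by move=> o; exact: state_indicator_norm.
Qed.

Lemma expectation_state t s : \int[Pr]_o ((St t o == s)%:R) = d s.
Proof.
elim: t s => [|t IH] s.
  rewrite state_indicatorE /Rintegral integral_indic ?setIT//.
  exact: (congr1 fine (traj_init traj s)).
have [] := @one_step _ _ _ _ _ _ mu M Pr d pb St At pb_policy traj t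
  (fun s1 a s' => 1 * (s' == s)%:R) (cst 1) _ _ (measurable_cst _) integrable_cst1.
- by move=> s1 s'; exact: measurable_cst.
- move=> s1 s'; apply: (@integrable_policy_trans _ _ _ _ 1) => // a.
  by rewrite mul1r; case: eqP; rewrite ?normr1 ?normr0.
move=> _; under eq_Rintegral do rewrite !mul1r.
move=> ->; under eq_bigr => s1 _.
  rewrite sum_kernel_indicator; under eq_Rintegral do rewrite mulr1.
  rewrite IH; under eq_Rintegral do rewrite mulr1; over.
by have [_ _] := d_stat; apply.
Qed.

Lemma measurable_past_ratio i j t : (t < i)%N -> (t < j)%N ->
  measurable_fun setT ((fun o => ratio pb St At q t o) : past i j -> R).
Proof.
move=> ti tj; apply: (@measurable_past_fun _ _ _ _ _ _ St At i j t (fun s a => q s a / pb s a)) => // s.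
apply: measurable_funM => //.
exact: measurable_funV_gt0.
Qed.

Definition followon_at t o := followon gamma (fun u => ratio pb St At q u o) t.

(** The indices t t matter: the trace at time t stops at the ratio of time t - 1, so it is still a
    function of the past before [a_t] is drawn, as [target_step] requires. *)
Lemma measurable_followon t : measurable_fun setT (followon_at t : past t t -> R).
Proof.
elim: t => [|t IH]; first exact: measurable_cst.
apply: measurable_funD => //; apply: measurable_funM.
  by apply: measurable_funM => //; exact: measurable_past_ratio.
exact: measurable_past_widen IH.
Qed.

Let measurable_followonS t : measurable_fun setT (followon_at t : past t.+1 t -> R).
Proof.
by apply: (@measurable_past_widen _ _ _ _ _ _ St At t t t.+1 t) => //;
  exact: measurable_followon.
Qed.

Let measurable_followonW t : measurable_fun setT (followon_at t : past t.+1 t.+1 -> R).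
Proof.
by apply: (@measurable_past_widen _ _ _ _ _ _ St At t t t.+1 t.+1) => //;
  exact: measurable_followon.
Qed.

Let bounded_indicator b : `|(nat_of_bool b)%:R : R| <= 1.
Proof. by case: b; rewrite ?normr1 ?normr0. Qed.

Lemma integrable_followon t : intg Pr (followon_at t).
Proof.
elim: t => [|t IH]; first exact: integrable_cst1.
have [] := @target_step t (fun _ _ _ => 1) _ _ _ (@measurable_followonS t) IH.
- by move=> s s'; exact: measurable_cst.
- move=> s s'; apply: (@integrable_policy_trans _ _ _ _ 1) => // a.
  by rewrite normr1.
move=> /(integrable_RZl gamma)/(integrable_RD integrable_cst1) + _.
rewrite (_ : (fun o => _) = followon_at t.+1)//.
by apply/funext => o; rewrite /followon_at /=; ring.
Qed.

Definition followon_mass t s := \int[Pr]_o ((St t o == s)%:R * followon_at t o).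

Lemma followon_massS t s' : followon_mass t.+1 s' =
  d s' + gamma * \sum_s followon_mass t s * state_kernel mu M q s s'.
Proof.
have [] := @target_step t (fun _ _ s1 => 1 * (s1 == s')%:R) _ _ _
  (@measurable_followonS t) (integrable_followon t).
- by move=> s s1; exact: measurable_cst.
- move=> s s1; apply: (@integrable_policy_trans _ _ _ _ 1) => // a.
  by rewrite mul1r.
move=> i1 e1.
transitivity (\int[Pr]_o ((St t.+1 o == s')%:R + gamma * (followon_at t o *
   (ratio pb St At q t o * (1 * (St t.+1 o == s')%:R))))).
  by apply: eq_Rintegral => o _; rewrite /followon_at /=; ring.
rewrite RintegralD//; last first.
- exact: integrable_RZl.
- have := integrable_state_indicator t.+1 s' integrable_cst1.
  by rewrite (_ : (fun o => _) = fun o => (St t.+1 o == s')%:R)//; apply/funext => o; rewrite mulr1.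
rewrite expectation_state RintegralZl// e1; congr (_ + _ * _).
apply: eq_bigr => s _; congr (_ * _).
rewrite (sum_kernel_indicator q (cst 1)).
by apply: eq_Rintegral => a _; rewrite mulr1.
Qed.

Variables (K : nat) (g : S -> A -> 'cV[R]_K) (C : R).
Hypotheses (g_meas : forall s i, measurable_fun setT (fun a => g s a i 0))
  (g_bound : forall s a i, `|g s a i 0| <= C).

Definition score_at i t o := followon_score gamma (fun u => ratio pb St At q u o)
  (fun u => g (St u o) (At u o)) t i 0.

Lemma score_atS i t o : score_at i t.+1 o =
  gamma * (followon_at t o * (ratio pb St At q t o * g (St t o) (At t o) i 0) +
           score_at i t o * (ratio pb St At q t o * 1)).
Proof. by rewrite /score_at /followon_at /= !mxE; ring. Qed.

Lemma measurable_score i t : measurable_fun setT (score_at i t : past t t -> R).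
Proof.
elim: t => [|t IH].
  by rewrite (_ : score_at i 0 = cst 0)//; apply/funext => o; rewrite /score_at mxE.
rewrite (_ : score_at i t.+1 = fun o => gamma *
  (followon_at t o * (ratio pb St At q t o * g (St t o) (At t o) i 0) +
           score_at i t o * (ratio pb St At q t o * 1))); last first.
  by apply/funext => o; rewrite score_atS.
have mr : measurable_fun setT ((fun o => ratio pb St At q t o) : past t.+1 t.+1 -> R).
  exact: measurable_past_ratio.
apply: measurable_funM => //; apply: measurable_funD.
  apply: measurable_funM; first by exact: measurable_followonW.
  apply: measurable_funM => //.
  exact: (@measurable_past_fun _ _ _ _ _ _ St At t.+1 t.+1 t (fun s a => g s a i 0)).
apply: measurable_funM; first by apply: (@measurable_past_widen _ _ _ _ _ _ St At t t t.+1 t.+1).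
exact: measurable_funM.
Qed.

Let measurable_scoreS i t : measurable_fun setT (score_at i t : past t.+1 t -> R).
Proof.
by apply: (@measurable_past_widen _ _ _ _ _ _ St At t t t.+1 t) => //;
  exact: measurable_score.
Qed.

Let qint s s' c := intg mu (fun a => q s a * trans M s a s' * c a).

Let qint1 s s' : qint s s' (cst 1).
Proof. by apply: (@integrable_policy_trans _ _ _ _ 1) => // a; rewrite normr1. Qed.

Let qint_score s s' i : qint s s' (fun a => g s a i 0).
Proof. exact: (@integrable_policy_trans _ _ _ _ C). Qed.

Let qint_ind s s' (c : A -> R) b : qint s s' c -> qint s s' (fun a => c a * (nat_of_bool b)%:R).
Proof.
by move=> /(integrable_RZl (nat_of_bool b)%:R); rewrite /qint; congr (intg mu _);
  apply/funext => a; ring.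
Qed.

Lemma integrable_score i t : intg Pr (score_at i t).
Proof.
elim: t => [|t IH].
  rewrite (_ : score_at i 0 = fun o => 0 * cst 1 o); last first.
    by apply/funext => o; rewrite /score_at mxE mul0r.
  by apply: integrable_RZl; exact: integrable_cst1.
have [i1 _] := @target_step t (fun s a _ => g s a i 0) _ (fun s _ => g_meas s i)
  (fun s s' => qint_score s s' i) (@measurable_followonS t) (integrable_followon t).
have [i2 _] := @target_step t (fun s a _ => 1) _ (fun _ _ => measurable_cst _)
  qint1 (@measurable_scoreS i t) IH.
have := integrable_RZl gamma (integrable_RD i1 i2).
by congr (intg Pr _); apply/funext => o; rewrite score_atS.
Qed.

Definition score_mass i t s := \int[Pr]_o ((St t o == s)%:R * score_at i t o).

(** The i-th partial derivative of the target state kernel when g is the score of q; [score_reward]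
    is likewise that of the mean reward. *)
Definition score_kernel s s' i := \int[mu]_a (q s a * trans M s a s' * g s a i 0).

Lemma score_massS i t s' : score_mass i t.+1 s' =
  gamma * (\sum_s followon_mass t s * score_kernel s s' i) +
  gamma * \sum_s score_mass i t s * state_kernel mu M q s s'.
Proof.
have [i1 e1] := @target_step t (fun s a s1 => g s a i 0 * (s1 == s')%:R) _
  (fun s s1 => measurable_funM (g_meas s i) (measurable_cst _))
  (fun s s1 => qint_ind _ (qint_score s s1 i)) (@measurable_followonS t) (integrable_followon t).
have mind (s s1 : S) : measurable_fun [set: A] (fun a => cst 1 a * (s1 == s')%:R : R).
  exact: measurable_funM.
have [i2 e2] := @target_step t (fun s a s1 => cst 1 a * (s1 == s')%:R) _
  (fun s s1 => mind s s1)
  (fun s s1 => qint_ind _ (qint1 s s1)) (@measurable_scoreS i t) (integrable_score i t).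
transitivity (\int[Pr]_o (gamma * (followon_at t o *
     (ratio pb St At q t o * (g (St t o) (At t o) i 0 * (St t.+1 o == s')%:R)) +
   score_at i t o * (ratio pb St At q t o * (cst 1 (At t o) * (St t.+1 o == s')%:R))))).
  by apply: eq_Rintegral => o _; rewrite score_atS /cst; ring.
rewrite RintegralZl//; last exact: integrable_RD.
rewrite RintegralD// e1 e2 mulrDr; congr (_ * _ + _ * _); apply: eq_bigr => s _; congr (_ * _).
  by rewrite (sum_kernel_indicator q (fun a => g s a i 0)).
rewrite (sum_kernel_indicator q (cst 1)).
by apply: eq_Rintegral => a _; rewrite mulr1.
Qed.

Variable v : S -> R.
Hypothesis reward_int : forall s s',
  intg mu (fun a => q s a * trans M s a s' * reward M s a s').

Let td s a s' := reward M s a s' + gamma * v s' - v s.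

Definition mean_reward s := \sum_s' \int[mu]_a (q s a * trans M s a s' * reward M s a s').

Definition score_reward s i :=
  \sum_s' \int[mu]_a (q s a * trans M s a s' * (g s a i 0 * reward M s a s')).

Let qint_scoreM s s' i c : measurable_fun setT c -> qint s s' c ->
  qint s s' (fun a => g s a i 0 * c a).
Proof.
move=> mc ic; apply: (@integrable_Rle _ _ _ _ _
    (fun a => C * `|q s a * trans M s a s' * c a|)).
- apply: measurable_funM; last exact: measurable_funM.
  by apply: measurable_funM => //; exact: measurable_trans.
- by move=> a; rewrite mulrCA normrM ler_wpM2r.
- by apply: integrable_RZl; exact: (integrable_abse ic).
Qed.

Let td_meas s s' : measurable_fun setT (fun a => td s a s').
Proof.
by apply: measurable_funB => //; apply: measurable_funD => //; exact: measurable_reward.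
Qed.

Let td_split s s' (f : A -> R) a : q s a * trans M s a s' * (f a * td s a s') =
  q s a * trans M s a s' * (f a * reward M s a s') +
  (gamma * v s' - v s) * (q s a * trans M s a s' * f a).
Proof. by rewrite /td; ring. Qed.

Let td_int s s' : qint s s' (fun a => td s a s').
Proof.
have := integrable_RD (reward_int s s') (integrable_RZl (gamma * v s' - v s) (qint1 s s')).
by rewrite /qint; congr (intg mu _); apply/funext => a; rewrite /td /cst; ring.
Qed.

Let sum_td s : \sum_s' \int[mu]_a (q s a * trans M s a s' * td s a s') =
  mean_reward s + gamma * (\sum_s' state_kernel mu M q s s' * v s') - v s.
Proof.
rewrite /mean_reward -[v s in RHS]mulr1 -(state_kernel_sum1 s q_policy) !mulr_sumr -big_split -sumrB/=.
apply: eq_bigr => s' _; rewrite /state_kernel.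
rewrite (@eq_Rintegral _ _ _ _ _ (fun a => q s a * trans M s a s' * reward M s a s' +
  (gamma * v s' - v s) * (q s a * trans M s a s' * cst 1 a))); last first.
  by move=> a _; rewrite /td /cst; ring.
rewrite RintegralD//; last by apply: integrable_RZl; exact: qint1.
rewrite RintegralZl//; last exact: qint1.
rewrite (@eq_Rintegral _ _ _ _ _ (fun a => q s a * trans M s a s') (fun a => _ * cst 1 a)).
  by ring.
by move=> a _; rewrite mulr1.
Qed.

Lemma expectation_critic t :
  \int[Pr]_o (followon_at t o * (ratio pb St At q t o * td (St t o) (At t o) (St t.+1 o))) =
  \sum_s followon_mass t s *
    (mean_reward s + gamma * (\sum_s' state_kernel mu M q s s' * v s') - v s).
Proof.
have [_ ->] := @target_step t td _ td_meas td_int (@measurable_followonS t) (integrable_followon t).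
by apply: eq_bigr => s _; rewrite sum_td.
Qed.

Lemma expectation_actor i t :
  (forall s, \sum_s' score_kernel s s' i = 0) ->
  \int[Pr]_o (ratio pb St At q t o * td (St t o) (At t o) (St t.+1 o) *
     (followon_at t o * g (St t o) (At t o) i 0 + score_at i t o)) =
  \sum_s followon_mass t s *
    (score_reward s i + gamma * \sum_s' score_kernel s s' i * v s') +
  \sum_s score_mass i t s *
    (mean_reward s + gamma * (\sum_s' state_kernel mu M q s s' * v s') - v s).
Proof.
move=> sk0.
have [i1 e1] := @target_step t (fun s a s' => g s a i 0 * td s a s') _
  (fun s s1 => measurable_funM (g_meas s i) (@td_meas s s1))
  (fun s s1 => qint_scoreM i (@td_meas s s1) (td_int s s1))
  (@measurable_followonS t) (integrable_followon t).
have [i2 e2] := @target_step t td _ td_meas td_int (@measurable_scoreS i t) (integrable_score i t).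
transitivity (\int[Pr]_o (followon_at t o *
     (ratio pb St At q t o * (g (St t o) (At t o) i 0 * td (St t o) (At t o) (St t.+1 o))) +
   score_at i t o * (ratio pb St At q t o * td (St t o) (At t o) (St t.+1 o)))).
  by apply: eq_Rintegral => o _; ring.
rewrite RintegralD// e1 e2; congr (_ + _); apply: eq_bigr => s _; congr (_ * _); last first.
  exact: sum_td.
(* The term [- v s] of the TD error is a baseline: it does not depend on the action, and the score
   has mean zero under q. *)
have Z : v s * \sum_s' score_kernel s s' i = 0 by rewrite sk0 mulr0.
rewrite -[LHS]addr0 -[X in _ + X]Z /score_reward !mulr_sumr -!big_split/=.
apply: eq_bigr => s' _.
under eq_Rintegral do rewrite (td_split s s' (fun a => g s a i 0)).
rewrite RintegralD//.
- rewrite RintegralZl//; last exact: qint_score.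
  by rewrite /score_kernel; ring.
- exact: (qint_scoreM i (measurable_reward M s s') (reward_int s s')).
- by apply: integrable_RZl; exact: qint_score.
Qed.

End off_policy_expectations.

(** * Limits *)

Section actor_critic_limits.
Context {R : realType} {S : finType}.
Variables (gamma : R) (P : S -> S -> R).
Hypotheses (gamma_ge0 : 0 <= gamma) (gamma_lt1 : gamma < 1).
Hypotheses (P_ge0 : forall s s', 0 <= P s s') (P_sum1 : forall s, \sum_s' P s s' = 1).
Variables (d r h v F : S -> R) (f : nat -> S -> R).
Hypotheses (hE : forall s, h s = r s + gamma * \sum_s' P s s' * h s')
  (FE : forall s', F s' = d s' + gamma * \sum_s F s * P s s')
  (fS : forall t s', f t.+1 s' = d s' + gamma * \sum_s f t s * P s s').

Let f_cvg s : f ^~ s @ \oo --> F s.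
Proof.
apply: (@discounted_occupancy_cvg _ _ gamma P _ _ _ _ (fun=> d) d F f) => // s'.
exact: cvg_cst.
Qed.

Let td s := r s + gamma * (\sum_s' P s s' * v s') - v s.

Let tdE s : td s = (h s - v s) - gamma * \sum_s' P s s' * (h s' - v s').
Proof.
under eq_bigr do rewrite mulrBr.
by rewrite sumrB /td {1}hE; ring.
Qed.

(** By [tdE] the mean TD error is [(I - gamma P) (h - v)], and F pairs with it to give [d (h - v)].
    A single scalar equation thus determines the average of v under d, though not v itself. *)
Lemma critic_limit : (fun t => \sum_s f t s * td s) @ \oo --> 0 ->
  \sum_s d s * v s = \sum_s d s * h s.
Proof.
move=> td0; apply/esym/eqP; rewrite -subr_eq0 -sumrB.
under eq_bigr do rewrite -mulrBr.
rewrite (@sum_discounted_occupancy _ _ gamma P _ F (fun s => h s - v s))//.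
under eq_bigr do rewrite -tdE.
have : (fun t => \sum_s f t s * td s) @ \oo --> \sum_s F s * td s.
  by apply: cvg_sumr => s; apply: cvgMl; exact: f_cvg.
by move=> /(cvg_unique _ td0) <-.
Qed.

Lemma actor_limit (Dr : S -> R) (DP : S -> S -> R) (y : nat -> S -> R) :
  (forall t s', y t.+1 s' = gamma * (\sum_s f t s * DP s s') +
                            gamma * \sum_s y t s * P s s') ->
  (fun t => \sum_s f t s * (Dr s + gamma * \sum_s' DP s s' * v s') +
            \sum_s y t s * td s) @ \oo -->
  \sum_s F s * (Dr s + gamma * \sum_s' DP s s' * h s').
Proof.
move=> yS; pose b s' := gamma * \sum_s F s * DP s s'.
have [Y YE] := discounted_occupancy_exists gamma_ge0 gamma_lt1 P_ge0 P_sum1 b.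
have y_cvg s : y ^~ s @ \oo --> Y s.
  apply: (@discounted_occupancy_cvg _ _ gamma P _ _ _ _
    (fun t s' => gamma * \sum_s f t s * DP s s') b Y y) => // s'.
  by apply: cvgMr; apply: cvg_sumr => s1; apply: cvgMl; exact: f_cvg.
(* [Y (I - gamma P) (h - v)] equals [b (h - v)], that is, [gamma F DP (h - v)]: the second trace
   supplies exactly the correction that replaces v by h in the first sum. *)
have -> : \sum_s F s * (Dr s + gamma * \sum_s' DP s s' * h s') =
    \sum_s F s * (Dr s + gamma * \sum_s' DP s s' * v s') + \sum_s Y s * td s.
  under [X in _ = _ + X]eq_bigr do rewrite tdE.
  rewrite -(sum_discounted_occupancy (fun s => h s - v s) YE).
  have -> : \sum_s b s * (h s - v s) =
      \sum_s F s * (gamma * \sum_s' DP s s' * (h s' - v s')).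
    rewrite /b; under eq_bigr do rewrite mulr_sumr mulr_suml.
    rewrite exchange_big/=; apply: eq_bigr => s _; rewrite !mulr_sumr.
    by apply: eq_bigr => s' _; ring.
  rewrite -big_split/=; apply: eq_bigr => s _; rewrite -mulrDr -addrA -mulrDr.
  rewrite -big_split/=; congr (_ * (_ + _ * _)); apply: eq_bigr => s' _; ring.
apply: cvgD; apply: cvg_sumr => s; apply: cvgMl; [exact: f_cvg|exact: y_cvg].
Qed.

End actor_critic_limits.

Lemma cvg_col {R : realType} {K : nat} (u : nat -> 'cV[R]_K) (l : 'cV[R]_K) :
  (forall i, (fun t => u t i 0) @ \oo --> l i 0) -> u @ \oo --> l.
Proof.
move=> ul; apply/cvgrPdist_le => e e0.
have H : \forall t \near \oo, forall i, `|l i 0 - u t i 0| <= e.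
  apply: filter_forall => i; move/cvgrPdist_le: (ul i); exact.
apply: filterS H => t H; rewrite [leLHS]/Num.norm /= mx_normrE.
apply: bigmax_le => [|[i j] _ /=]; first exact: ltW.
by rewrite !mxE ord1.
Qed.

Lemma vec_expectationE {R : realType} {dO : measure_display} {Omega : measurableType dO}
    (Pr : probability Omega R) n (X : Omega -> 'cV[R]_n) i :
  vec_expectation Pr X i 0 = \int[Pr]_o X o i 0.
Proof. by rewrite mxE unlock. Qed.

Lemma first_order_cst_eq0 {R : realType} {K : nat} (c : R) (w : 'cV[R]_K) G :
  first_order (cst c) w G -> forall i, G i = 0.
Proof.
move=> /first_order_gradient[_ +] i => /colP/(_ i).
by rewrite !mxE derive_cst => <-.
Qed.

Theorem theorem4 (R : realType) (S : finType)
  (dA dO : measure_display) (A : measurableType dA) (Omega : measurableType dO)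
  (mu : {sigma_finite_measure set A -> \bar R}) (M : mdp R S A)
  (gamma : R) (gamma_ge0 : 0 <= gamma) (gamma_lt1 : gamma < 1)
  (* behavior policy and its stationary state process *)
  (pb : S -> A -> R) (pb_policy : is_policy mu pb)
  (pb_gt0 : forall s a, 0 < pb s a)
  (kernel_irr : irreducible_kernel (state_kernel mu M pb))
  (kernel_aper : aperiodic_kernel (state_kernel mu M pb))
  (d : S -> R) (d_stat : stationary_distribution (state_kernel mu M pb) d)
  (d_gt0 : forall s, 0 < d s)
  (* data *)
  (Pr : probability Omega R) (St : nat -> Omega -> S) (At : nat -> Omega -> A)
  (traj : is_trajectory Pr mu M d pb St At)
  (* target policy *)
  (K : nat) (p : 'cV[R]_K -> S -> A -> R)
  (p_policy : forall w, is_policy mu (p w))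
  (p_gt0 : forall w s a, 0 < p w s a)
  (p_diff2 : forall s a, twice_differentiable (fun w => p w s a))
  (p_score : bounded_score p)
  (p_score_deriv : score_bounded_derivative p)
  (* features *)
  (n : nat) (phi : S -> 'cV[R]_n.+1)
  (phi_free : row_free (feature_mx phi)^T)
  (phi_last : forall s, phi s ord_max 0 = 1)
  (lambda : R) (lambda_ge0 : 0 <= lambda) (lambda_le1 : lambda <= 1)
  (* the Emphatic-TD(lambda)-solution *)
  (theta : 'cV[R]_K -> 'cV[R]_n.+1)
  (theta_sol : forall w,
     is_etd_solution M gamma lambda phi pb St At Pr (p w) (theta w))
  (* finiteness of the expectations involved *)
  (etd_integrable : forall w t, vec_integrable Pr
     (etd_update M gamma lambda phi pb St At (p w) (theta w) t))
  (actor_integrable : forall w t, vec_integrable Pr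
     (actor_update M gamma lambda phi pb St At p w (theta w) t)) :
  let J := fun w => \sum_s d s * value phi (theta w) s in
  forall w : 'cV[R]_K,
    differentiable J w /\
    (fun t => vec_expectation Pr
       (actor_update M gamma lambda phi pb St At p w (theta w) t)) @ \oo -->
      gradient J w.
Proof.
move=> J w.
have [C pC] := p_score.
have p_meas x s : measurable_fun setT (p x s) by have [] := p_policy x s.
have p_d s a x : differentiable (fun y => p y s a) x by have [] := p_diff2 s a.
have kge0 x := fun s s' => state_kernel_ge0 M s s' (p_policy x).
have ksum1 x := fun s => state_kernel_sum1 M s (p_policy x).
have g_meas x s i : measurable_fun [set: A] (fun a => score p x s a i 0).
  by apply: (@measurable_log_gradient _ _ _ _ (fun y a => p y s a)) => //.
have g_bound x s a i : `|score p x s a i 0| <= C.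
  by apply: le_trans (pC x s a); exact: mx_entry_le_norm.
have last_update x t o : etd_update M gamma lambda phi pb St At (p x) (theta x) t o ord_max 0 =
    ratio pb St At (p x) t o * td_error M gamma phi St At (theta x) t o *
    followon_at pb (p x) St At gamma t o.
  by rewrite mxE e_trace_last.
have cst1_le (a : A) : `|(cst 1 : A -> R) a| <= 1 by rewrite normr1.
(* At t = 0 the last entry of the ETD update is the ratio times the TD error alone, and its
   integrability passes to the action integrals because every state has positive mass. Subtracting
   the bounded value terms leaves the reward. *)
have rew_int x s s' : mu.-integrable setT
    (EFin \o (fun a => p x s a * trans M s a s' * reward M s a s')).
  pose v := value phi (theta x).
  pose c s a s' := p x s a / pb s a * (reward M s a s' + gamma * v s' - v s).
  have ic : Pr.-integrable setT (EFin \o (fun o => c (St 0%N o) (At 0%N o) (St 1%N o))).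
    have := etd_integrable x 0%N ord_max; congr (Pr.-integrable _ _).
    by apply/funext => o; rewrite last_update mulr1.
  have mc s1 s2 : measurable_fun setT (fun a => c s1 a s2).
    apply: measurable_funM.
      apply: measurable_funM => //; apply: measurable_funV_gt0 => //.
      by have [] := pb_policy s1.
    apply: measurable_funB => //; apply: measurable_funD => //.
    exact: measurable_reward.
  have i1 := integrable_transition pb_policy traj s' (d_gt0 s) mc ic.
  have i2 := @integrable_policy_trans _ _ _ _ mu M (p x) s s' (cst 1) 1 (p_policy x)
     (measurable_cst _) cst1_le.
  have := integrable_RB i1 (integrable_RZl (gamma * v s' - v s) i2).
  congr (mu.-integrable _ _); apply/funext => a /=; congr (_%:E); rewrite /c /cst.
  by field; rewrite gt_eqF.
pose P x := state_kernel mu M (p x).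
pose r x := mean_reward mu M (p x).
have /choice[h hE] x : exists h, forall s, h s = r x s + gamma * \sum_s' P x s s' * h s'.
  exact: (discounted_value_exists gamma_ge0 gamma_lt1 (kge0 x) (ksum1 x)).
have occ x : exists F, forall s', F s' = d s' + gamma * \sum_s F s * P x s s'.
  exact: (discounted_occupancy_exists gamma_ge0 gamma_lt1 (kge0 x) (ksum1 x)).
(* This uses the last coordinate of the ETD equation at every x, so that J and [d h] agree as
   functions and may be differentiated alike. *)
have JE : J = fun x => \sum_s d s * h x s.
  apply/funext => x; have [F FE] := occ x.
  apply: (@critic_limit _ _ gamma (P x) _ _ _ _ d (r x) (h x) _ F
    (followon_mass Pr pb (p x) St At gamma)) => //.
  - exact: kge0.
  - exact: ksum1.
  - by move=> t s'; apply: followon_massS.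
  have L0 := continuous_cvg _ (@coord_continuous R n.+1 1 ord_max 0 0) (theta_sol x).
  rewrite mxE in L0.
  suff -> : (fun t => \sum_s followon_mass Pr pb (p x) St At gamma t s *
      (r x s + gamma * (\sum_s' P x s s' * value phi (theta x) s') - value phi (theta x) s)) =
      (fun t => vec_expectation Pr (etd_update M gamma lambda phi pb St At (p x) (theta x) t)
        ord_max 0) by exact: L0.
  apply/funext => t; rewrite vec_expectationE.
  rewrite -(@expectation_critic _ _ _ _ _ _ mu M Pr d pb (p x) St At gamma)//.
  by apply: eq_Rintegral => o _; rewrite last_update [RHS]mulrC.
have [F FE] := occ w.
pose DP := score_kernel mu M (p w) (score p w).
pose Dr := score_reward mu M (p w) (score p w).
have diff_int s (c : A -> R) : measurable_fun setT c ->
    mu.-integrable setT (EFin \o (fun a => p w s a * c a)) ->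
    first_order (fun x => \int[mu]_a (p x s a * c a)) w
      (fun i => \int[mu]_a (p w s a * score p w s a i 0 * c a)).
  move=> mc ic; apply: (@first_order_integral _ _ _ _ mu (fun x a => p x s a) C) => //.
  by move=> a x; exact: (pC a s x).
have tr_meas s s' : measurable_fun [set: A] (fun a => trans M s a s').
  exact: measurable_trans.
have P_diff s s' : first_order (fun x => P x s s') w (DP s s').
  have := diff_int s (fun a => trans M s a s') (tr_meas s s').
  rewrite [DP s s'](_ : _ = fun i => \int[mu]_a (p w s a * score p w s a i 0 * trans M s a s')).
    apply; have := @integrable_policy_trans _ _ _ _ mu M (p w) s s' (cst 1) 1 (p_policy w)
     (measurable_cst _) cst1_le.
    by congr (mu.-integrable _ _); apply/funext => a /=; rewrite mulr1.
  by apply/funext => i; apply: eq_Rintegral => a _; ring.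
have r_diff s : first_order (fun x => r x s) w (Dr s).
  rewrite [Dr s](_ : _ = fun i => \sum_s' \int[mu]_a (p w s a * score p w s a i 0 *
      (trans M s a s' * reward M s a s'))).
    rewrite /r /mean_reward; apply: (@first_order_sum _ _ S
      (fun s' x => \int[mu]_a (p x s a * trans M s a s' * reward M s a s'))) => s'.
    rewrite (_ : (fun x => _) = fun x => \int[mu]_a (p x s a *
      (trans M s a s' * reward M s a s'))); last first.
      by apply/funext => x; apply: eq_Rintegral => a _; rewrite mulrA.
    apply: diff_int.
      by apply: measurable_funM => //; exact: measurable_reward.
    by have := rew_int w s s'; congr (mu.-integrable _ _); apply/funext => a /=; rewrite mulrA.
  apply/funext => i; apply: eq_bigr => s' _; apply: eq_Rintegral => a _; ring.
(* Differentiating the constant row sums of [P x] gives the zero mean of the score, through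
   uniqueness of the gradient. *)
have sk0 s i : \sum_s' DP s s' i = 0.
  have : first_order (cst 1) w (fun i => \sum_s' DP s s' i).
    have -> : cst 1 = fun x => \sum_s' P x s s'.
      by apply/funext => x; rewrite [RHS]ksum1.
    exact: first_order_sum.
  by move=> /first_order_cst_eq0/(_ i).
have JG : first_order J w (fun i => \sum_s F s * (Dr s i + gamma * \sum_s' DP s s' i * h w s')).
  by rewrite JE; apply: (@discounted_value_first_order _ _ _ gamma P r h).
have [dJ gJ] := first_order_gradient JG; split=> //.
apply: cvg_col => i; rewrite gJ mxE.
have := @actor_limit _ _ gamma (P w) gamma_ge0 gamma_lt1 (kge0 w) (ksum1 w) d (r w) (h w)
  (value phi (theta w)) F (followon_mass Pr pb (p w) St At gamma) (hE w) FE _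
  (Dr ^~ i) (fun s s' => DP s s' i) (score_mass Pr pb (p w) St At gamma (score p w) i).
have fS t s' : followon_mass Pr pb (p w) St At gamma t.+1 s' =
    d s' + gamma * \sum_s followon_mass Pr pb (p w) St At gamma t s * P w s s'.
  by apply: followon_massS.
move=> /(_ fS); have smS t s' := @score_massS _ _ _ _ _ _ mu M Pr d pb (p w) St At gamma
  pb_policy (p_policy w) pb_gt0 traj K (score p w) C (g_meas w) (g_bound w) i t s'.
move=> /(_ smS) L.
suff -> : (fun t => vec_expectation Pr
      (actor_update M gamma lambda phi pb St At p w (theta w) t) i 0) =
    (fun t => \sum_s followon_mass Pr pb (p w) St At gamma t s *
       (Dr s i + gamma * \sum_s' DP s s' i * value phi (theta w) s') +
     \sum_s score_mass Pr pb (p w) St At gamma (score p w) i t s *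
       (r w s + gamma * (\sum_s' P w s s' * value phi (theta w) s') - value phi (theta w) s))
  by exact: L.
apply/funext => t; rewrite vec_expectationE.
rewrite -(@expectation_actor _ _ _ _ _ _ mu M Pr d pb (p w) St At gamma pb_policy (p_policy w)
  pb_gt0 traj K (score p w) C (g_meas w) (g_bound w) (value phi (theta w)) (rew_int w) i t (sk0^~ i)).
by apply: eq_Rintegral => o _; rewrite mxE psi_traceE !mxE.
Qed.
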